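(* For $1\le i\le d$ let $(X_i,d_i,m_i)$ be a compact metric space with $m_i$ a $\delta_i$-Ahlfors regular measure, and let $X^\times=\prod_iX_i$ with $d^\times=\max_i d_i$ and $m^\times=\prod_i m_i$. Let $J,\beta,\{l_n\},\{u_n\},J_n,\rho,\bm a$ be as in the context, let $\{\bm t_n\}_{n\ge1}$ be a sequence in $(\mathbb R^+)^d$, and for each $i$ let $\{\mathcal R_{\alpha,i}:\alpha\in J\}$ be subsets of $X_i$ with the $\kappa_i$-scaling property ($0\le\kappa_i<1$). Assume $(\{\mathcal R^\times_\alpha\}_{\alpha\in J},\beta)$ is a uniform local ubiquity system for rectangles with respect to $(\rho,\bm a)$. Let $s=\limsup_{n\to\infty}s(\bm t_n)$. Then $W(\{\bm t_n\})\in\mathscr G_1^s(X^\times)$. If moreover $s$ is attained along a nonincreasing subsequence (i.e. there is a subsequence $(n_k)$ with $s(\bm t_{n_k})$ nonincreasing in $k$ and converging to $s$), then $W(\{\bm t_n\})\in\mathscr G^s(X^\times)$.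
   Context: $m_i$ is $\delta_i$-Ahlfors regular if $m_i(B(x,r))\asymp r^{\delta_i}$. $J$ is an infinite countable index set; $\beta:J\to\mathbb R^+$ with $\{\alpha:\beta(\alpha)<M\}$ finite for every $M>1$; $l_n<u_n$, $l_n\to\infty$; $J_n=\{\alpha: l_n<\beta(\alpha)\le u_n\}$; $\rho$ non-increasing with $\rho(u)\to0$; $\bm a\in(\mathbb R^+)^d$. $\Delta(\mathcal R,\eta)$ is the open $\eta$-neighbourhood of $\mathcal R$. $\kappa_i$-scaling: for all $0<\eta\le r<|X_i|$, $\alpha\in J$, $x\in\mathcal R_{\alpha,i}$: $\eta^{\delta_i(1-\kappa_i)}r^{\delta_i\kappa_i}\asymp m_i(B(x,r)\cap\Delta(\mathcal R_{\alpha,i},\eta))$. $\mathcal R^\times_\alpha=\prod_i\mathcal R_{\alpha,i}$, $\Delta(\mathcal R^\times_\alpha,r^{\bm b})=\prod_i\Delta(\mathcal R_{\alpha,i},r^{b_i})$. Uniform local ubiquity: there is $c>0$ such that for every ball $B\subset X^\times$, $\liminf_{n\to\infty}m^\times(B\cap\bigcup_{\alpha\in J_n}\Delta(\mathcal R^\times_\alpha,\rho(u_n)^{\bm a}))>c\,m^\times(B)$. $W(\{\bm t_n\})=\{x: x\in\Delta(\mathcal R^\times_\alpha,\rho(u_n)^{\bm a+\bm t_n})\text{ for some }\alpha\in J_n,\text{ for infinitely many } n\}$. For $\bm t=(t_1,\dots,t_d)$: $\mathcal A=\{a_i,a_i+t_i\}$, $\mathcal K_1(\tau)=\{i:a_i\ge\tau\}$,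 $\mathcal K_2(\tau)=\{i:a_i+t_i\le\tau\}\setminus\mathcal K_1(\tau)$, $\mathcal K_3(\tau)$ the rest, and $s(\bm t)=\min_{\tau\in\mathcal A}\{\sum_{\mathcal K_1(\tau)}\delta_i+\sum_{\mathcal K_2(\tau)}\delta_i+\sum_{\mathcal K_3(\tau)}\delta_i\kappa_i+(\sum_{\mathcal K_3(\tau)}\delta_ia_i(1-\kappa_i)-\sum_{\mathcal K_2(\tau)}\delta_it_i(1-\kappa_i))/\tau\}$. $\mathcal H^t_\infty(A)=\inf\{\sum|B_i|^t:A\subset\bigcup B_i\text{ balls}\}$. $\mathscr G^s(X^\times)$: $G_\delta$ sets $A$ with $c>0$ such that $\mathcal H^s_\infty(A\cap B)>c\mathcal H^s_\infty(B)$ for all balls $B$. $\mathscr G_1^s(X^\times)$: $G_\delta$ sets $A$ with $c>0$ such that $\mathcal H^t_\infty(A\cap B)>c\mathcal H^t_\infty(B)$ for all $0<t<s$ and all balls $B$. *)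

(* Defs.v *)
From HB Require Import structures.
From mathcomp Require Import all_boot all_order all_algebra.
From mathcomp Require Import all_classical all_reals all_analysis.
From mathcomp Require Import borel_hierarchy.

Set Implicit Arguments.
Unset Strict Implicit.
Unset Printing Implicit Defensive.

Import Order.TTheory GRing.Theory Num.Theory.
Import numFieldTopology.Exports numFieldNormedType.Exports.

Local Open Scope classical_set_scope.
Local Open Scope ring_scope.

(* The library's measurable types are pointed, so Borel measures on a metric
   space need the join of both structures. *)
#[short(type="pmetricType")]
HB.structure Definition PMetric (K : numDomainType) :=
  { M of Metric K M & Pointed M }.

Notation borelType T := (g_sigma_algebraType (@open T)).

(* The library already puts the product topology on [forall i, X i]; this alias
   carries the maximum metric instead. *)
Definition maxprod (R : realType) (d : nat) (X : 'I_d -> pmetricType R) : Type :=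
  forall i, X i.

Section maxprod_metric.
Context {R : realType} {d : nat} (X : 'I_d -> pmetricType R).

Definition maxdist (x y : maxprod X) : R :=
  \big[Num.max/0]_(i < d) mdist (x i) (y i).

Lemma maxdist_ge (x y : maxprod X) i : mdist (x i) (y i) <= maxdist x y.
Proof. exact: (le_bigmax 0 (fun i => mdist (x i) (y i)) i). Qed.

Lemma maxdistxx x : maxdist x x = 0.
Proof.
apply/eqP; rewrite eq_le bigmax_ge_id andbT.
by apply: bigmax_le => // i _; rewrite mdistxx.
Qed.

Lemma maxdist_positivity x y : maxdist x y = 0 -> x = y.
Proof.
move=> xy0; apply: functional_extensionality_dep => i.
apply: mdist_positivity; apply/eqP; rewrite eq_le mdist_ge0 andbT -xy0.
exact: maxdist_ge.
Qed.

Lemma maxdist_sym x y : maxdist x y = maxdist y x.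
Proof. by apply: eq_bigr => i _; exact: metric_sym. Qed.

Lemma maxdist_triangle y x z : maxdist x z <= maxdist x y + maxdist y z.
Proof.
apply/bigmax_leP; split => [|i _]; first by rewrite addr_ge0// bigmax_ge_id.
by rewrite (le_trans (metric_triangle _ (y i) _))// lerD// maxdist_ge.
Qed.

HB.instance Definition _ := gen_eqMixin (maxprod X).
HB.instance Definition _ := gen_choiceMixin (maxprod X).
HB.instance Definition _ := @isMetric.Build R (maxprod X) maxdist
  maxdistxx maxdist_positivity maxdist_sym maxdist_triangle.
HB.instance Definition _ := isPointed.Build (maxprod X) (fun=> point).

End maxprod_metric.

Section metric_notions.
Context {R : realType}.

(* Only meaningful for bounded sets: [sup] of an unbounded set is 0. *)
Definition diam (T : metricType R) (A : set T) : R :=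
  sup [set mdist p.1 p.2 | p in A `*` A].

Definition nbhd (T : metricType R) (A : set T) (eta : R) : set T :=
  \bigcup_(y in A) ball y eta.

Definition comparable_up_to (C : R) (u : R) (v : \bar R) : Prop :=
  ((C^-1 * u)%:E <= v)%E /\ (v <= (C * u)%:E)%E.

(* As for the scaling property below, radii range over 0 < r < |T|; the first
   clause excludes the one-point space, for which that range is empty. *)
Definition ahlfors_regular (T : pmetricType R)
    (m : {measure set (borelType T) -> \bar R}) (delta : R) : Prop :=
  0 < diam [set: T] /\
  exists2 C : R, 0 < C & forall (x : T) (r : R), 0 < r -> r < diam [set: T] ->
    comparable_up_to C (r `^ delta) (m (ball x r)).

Definition kappa_scaling (T : pmetricType R)
    (m : {measure set (borelType T) -> \bar R}) (delta kappa : R)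
    (J : Type) (Res : J -> set T) : Prop :=
  exists2 C : R, 0 < C & forall (eta r : R) (alpha : J) (x : T),
    0 < eta -> eta <= r -> r < diam [set: T] -> Res alpha x ->
    comparable_up_to C (eta `^ (delta * (1 - kappa)) * r `^ (delta * kappa))
      (m (ball x r `&` nbhd (Res alpha) eta)).

(* Covers are countable, possibly finite, families of balls: they are indexed by
   an arbitrary set I of naturals. Note [a `^ 0 = 1] even for a = 0. *)
Definition hausdorff_content (T : metricType R) (t : R) (A : set T) : \bar R :=
  ereal_inf [set e | exists (I : set nat) (x : nat -> T) (r : nat -> R),
    [/\ forall k, I k -> 0 < r k,
        A `<=` \bigcup_(k in I) ball (x k) (r k) &
        e = \esum_(k in I) ((diam (ball (x k) (r k))) `^ t)%:E]].

(* The classes G^s and G_1^s of sets with the large intersection property. *)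
Definition large_inter (T : metricType R) (s : R) (A : set T) : Prop :=
  Gdelta A /\
  exists2 c : R, 0 < c & forall (x : T) (r : R), 0 < r ->
    (c%:E * hausdorff_content s (ball x r)
      < hausdorff_content s (A `&` ball x r))%E.

Definition large_inter1 (T : metricType R) (s : R) (A : set T) : Prop :=
  Gdelta A /\
  exists2 c : R, 0 < c & forall (t : R) (x : T) (r : R),
    0 < t -> t < s -> 0 < r ->
    (c%:E * hausdorff_content t (ball x r)
      < hausdorff_content t (A `&` ball x r))%E.

End metric_notions.

Section rectangles.
Context {R : realType} {d : nat}.

(* This determines mX when the m i are finite: measurable boxes are stable under
   intersection, and generate the Borel sets since the X i are separable. *)
Definition is_product_measure (X : 'I_d -> pmetricType R)
    (m : forall i, {measure set (borelType (X i)) -> \bar R})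
    (mX : {measure set (borelType (maxprod X)) -> \bar R}) : Prop :=
  forall A : (forall i, set (borelType (X i))), (forall i, measurable (A i)) ->
    mX [set x | forall i, A i (x i)] = (\big[*%E/1]_(i < d) m i (A i))%E.

(* The neighbourhood of R_alpha^x with side r^(b_i) in direction i. *)
Definition rect_nbhd (X : 'I_d -> pmetricType R) (J : Type)
    (Res : forall i, J -> set (X i)) (alpha : J) (r : R) (b : 'I_d -> R) :
    set (maxprod X) :=
  [set x | forall i, nbhd (Res i alpha) (r `^ b i) (x i)].

Definition Jn (J : Type) (beta : J -> R) (l u : nat -> R) (n : nat) : set J :=
  [set alpha | l n < beta alpha <= u n].

Definition uniform_local_ubiquity (X : 'I_d -> pmetricType R)
    (mX : {measure set (borelType (maxprod X)) -> \bar R})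
    (J : Type) (beta : J -> R) (l u : nat -> R)
    (Res : forall i, J -> set (X i)) (rho : R -> R) (a : 'I_d -> R) : Prop :=
  exists2 c : R, 0 < c & forall (x : maxprod X) (r : R), 0 < r ->
    (c%:E * mX (ball x r) <
     limn_einf (fun n => mX (ball x r `&`
       \bigcup_(alpha in Jn beta l u n) rect_nbhd Res alpha (rho (u n)) a)))%E.

Definition W (X : 'I_d -> pmetricType R)
    (J : Type) (beta : J -> R) (l u : nat -> R)
    (Res : forall i, J -> set (X i)) (rho : R -> R) (a : 'I_d -> R)
    (t : nat -> 'I_d -> R) : set (maxprod X) :=
  [set x | infinite_set [set n | exists2 alpha, Jn beta l u n alpha &
    rect_nbhd Res alpha (rho (u n)) (fun i => a i + t n i) x]].

Definition K1 (a : 'I_d -> R) (tau : R) : {set 'I_d} := [set i | tau <= a i].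

Definition K2 (a t : 'I_d -> R) (tau : R) : {set 'I_d} :=
  [set i | a i + t i <= tau] :\: K1 a tau.

Definition K3 (a t : 'I_d -> R) (tau : R) : {set 'I_d} :=
  ~: (K1 a tau :|: K2 a t tau).

Definition dim_at (delta kappa a t : 'I_d -> R) (tau : R) : R :=
  \sum_(i in K1 a tau) delta i + \sum_(i in K2 a t tau) delta i
  + \sum_(i in K3 a t tau) delta i * kappa i
  + (\sum_(i in K3 a t tau) delta i * a i * (1 - kappa i)
     - \sum_(i in K2 a t tau) delta i * t i * (1 - kappa i)) / tau.

(* The infimum is a minimum: the set of values is finite, and nonempty as soon
   as d > 0. *)
Definition rect_dim (delta kappa a t : 'I_d -> R) : R :=
  inf [set dim_at delta kappa a t tau |
        tau in range a `|` range (fun i => a i + t i)].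

End rectangles.

(* Main.v *)
Require Import Defs.
From mathcomp Require Import all_boot all_order all_algebra.
From mathcomp Require Import all_classical all_reals all_analysis.
From mathcomp Require Import borel_hierarchy ring lra.

(** Let [D] be the sum of the [delta i]. Fix [T] with [T <= rect_dim (t n)] for
    infinitely many [n], and call [E n] the union of the shrunken rectangles of
    level [n].

    - In a ball of radius [r], ubiquity provides separated rectangles of level [n]
      which fill a fixed proportion of the measure. Restrict [mX] to their
      intersections with [E n]: after normalisation this has mass at least
      [c r^D], and by the scaling property gives a ball of radius [rho^tau] a mass
      at most [C rho^(F tau)], where [F] is piecewise affine with breakpoints
      [a i] and [a i + t i], and [dim_at tau = F tau / tau] at the breakpoints.
      Hence [F tau >= rect_dim * tau] for all [tau], a Frostman condition with
      exponent [T].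
    - Let balls of diameters [d_k] cover [limsup E] inside a ball of radius [r],
      with sum of [d_k ^ T] less than [c0 r^T]. Averaging against [mX] gives a
      ball of radius [e] where this sum is at most [eta e^D], with [eta] as small
      as we want; averaging against the restricted measure gives inside it a ball
      of radius [e'], contained in [E n], where it is again less than [c0 e'^T].
      Iterating, nested balls shrink to a point of [limsup E] which no ball of the
      cover can contain. The constant [c0] does not depend on [T]. *)

Set Implicit Arguments.
Unset Strict Implicit.
Unset Printing Implicit Defensive.

Import Order.TTheory GRing.Theory Num.Theory.
Import numFieldTopology.Exports numFieldNormedType.Exports.

Local Open Scope classical_set_scope.
Local Open Scope ring_scope.

(** * The piecewise affine mass exponent *)

Section rect_exponent.
Context {R : realType} {d : nat}.

(** As a function of [tau >= 0] this vanishes at 0 and, for [0 <= a] and [0 <= t], has slope [de] up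
    to [a], slope [de * ka] between [a] and [a + t], and slope [de] again afterwards. *)
Definition exponent1 (de ka a t tau : R) : R :=
  de * (Num.min tau a + ka * (Num.max tau a - a)
        + (1 - ka) * (Num.max tau (a + t) - (a + t))).

Definition exponent (delta kappa a t : 'I_d -> R) tau : R :=
  \sum_i exponent1 (delta i) (kappa i) (a i) (t i) tau.

(** The identity holds direction by direction: [K1], [K3] and [K2] select, in this order, the three
    affine regimes of [exponent1]. *)
Lemma dim_atE (delta kappa a t : 'I_d -> R) tau : 0 < tau ->
  (forall i, 0 < t i) ->
  dim_at delta kappa a t tau * tau = exponent delta kappa a t tau.
Proof.
move=> tau0 t0; rewrite /dim_at /exponent mulrDl mulfVK ?gt_eqF//.
rewrite 5!(big_mkcond (fun i => i \in _))/= !mulrDl !mulr_suml -sumrN -!big_split/=.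
apply: eq_bigr => i _.
rewrite /K3 /K2 /K1 !inE /exponent1; have := t0 i.
case: (leP tau (a i)) => /= h1; case: (leP (a i + t i) tau) => /= h2 ti0;
  [lra|ring..].
Qed.

Lemma exponent1_le_lin (de ka a t tau : R) : 0 <= de -> 0 <= ka -> ka <= 1 -> 0 < t ->
  exponent1 de ka a t tau <= de * tau.
Proof.
move=> de0 ka0 ka1 t0; rewrite /exponent1 ler_wpM2l//.
case: (leP tau a) => h1; case: (leP tau (a + t)) => h2; nra.
Qed.

Lemma exponent1_ge0 (de ka a t tau : R) : 0 <= de -> 0 <= ka -> ka <= 1 ->
  0 <= a -> 0 <= tau -> 0 <= exponent1 de ka a t tau.
Proof.
move=> de0 ka0 ka1 t0 tau0; rewrite /exponent1 mulr_ge0// addr_ge0//.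
  by rewrite addr_ge0// ?le_min ?tau0// mulr_ge0// subr_ge0 le_max lexx orbT.
by rewrite mulr_ge0 ?subr_ge0// le_max lexx orbT.
Qed.

(** The last two hypotheses keep both breakpoints out of the interior of [[p, q]]. Interpolation is
    written without division, so that [p = q] is allowed. *)
Lemma exponent1_affine (de ka a t p q tau : R) : 0 < t ->
  p <= tau -> tau <= q ->
  (a <= p) || (q <= a) -> (a + t <= p) || (q <= a + t) ->
  exponent1 de ka a t tau * (q - p) =
  exponent1 de ka a t p * (q - tau) + exponent1 de ka a t q * (tau - p).
Proof.
move=> t0 pt tq ha hat; rewrite /exponent1.
have E (x y : R) : x <= y -> Num.max x y = y /\ Num.min x y = x.
  by move=> xy; rewrite max_r// min_l.
have E' (x y : R) : y <= x -> Num.max x y = x /\ Num.min x y = y.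
  by move=> xy; rewrite max_l// min_r.
case/orP: ha => ha; case/orP: hat => hat.
- have [-> ->] := E' p a ltac:(lra); have [-> ->] := E' q a ltac:(lra).
  have [-> ->] := E' tau a ltac:(lra); have [-> _] := E' p (a + t) ltac:(lra).
  have [-> _] := E' q (a + t) ltac:(lra).
  by have [-> _] := E' tau (a + t) ltac:(lra); ring.
- have [-> ->] := E' p a ltac:(lra); have [-> ->] := E' q a ltac:(lra).
  have [-> ->] := E' tau a ltac:(lra); have [-> _] := E p (a + t) ltac:(lra).
  have [-> _] := E q (a + t) ltac:(lra).
  by have [-> _] := E tau (a + t) ltac:(lra); ring.
(* This case is contradictory, since [q <= a < a + t <= p <= q]. *)
- have [qtau pE] : q = tau /\ p = tau by split; lra.
  by rewrite qtau pE; ring.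
- have [-> ->] := E p a ltac:(lra); have [-> ->] := E q a ltac:(lra).
  have [-> ->] := E tau a ltac:(lra); have [-> _] := E p (a + t) ltac:(lra).
  have [-> _] := E q (a + t) ltac:(lra).
  by have [-> _] := E tau (a + t) ltac:(lra); ring.
Qed.

Lemma exponent1_affine_end (de ka a t p tau : R) : 0 < t ->
  p <= tau -> a + t <= p ->
  exponent1 de ka a t tau = exponent1 de ka a t p + de * (tau - p).
Proof.
move=> t0 pt ha; rewrite /exponent1.
have E' (x y : R) : y <= x -> Num.max x y = x /\ Num.min x y = y.
  by move=> xy; rewrite max_l// min_r.
have [-> ->] := E' p a ltac:(lra); have [-> ->] := E' tau a ltac:(lra).
have [-> _] := E' p (a + t) ltac:(lra).
by have [-> _] := E' tau (a + t) ltac:(lra); ring.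
Qed.

End rect_exponent.

(** * The dimension as a lower bound for the exponent *)

Section rect_dim_bounds.
Context {R : realType} {d : nat} (delta kappa a t : 'I_d -> R).
Context (d_gt0 : (0 < d)%N) (delta_gt0 : forall i, 0 < delta i)
  (kappa_ge0 : forall i, 0 <= kappa i) (kappa_lt1 : forall i, kappa i < 1)
  (a_gt0 : forall i, 0 < a i) (t_gt0 : forall i, 0 < t i).

Local Notation F := (exponent delta kappa a t).
Local Notation A := (range a `|` range (fun i => a i + t i)).

Let node_gt0 tau : A tau -> 0 < tau.
Proof. by move=> [|] [i _ <-]; rewrite ?addr_gt0. Qed.

Let dim_at_ge0 tau : A tau -> 0 <= dim_at delta kappa a t tau.
Proof.
move=> /node_gt0 tau0; rewrite -(pmulr_lge0 _ tau0) dim_atE//.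
by apply: sumr_ge0 => i _; apply: exponent1_ge0 => //; rewrite ltW.
Qed.

Lemma rect_dim_ge0 : 0 <= rect_dim delta kappa a t.
Proof.
apply: lb_le_inf.
  by exists (dim_at delta kappa a t (a (Ordinal d_gt0))); eexists; [left; eexists|].
by move=> _ [tau Atau <-]; exact: dim_at_ge0.
Qed.

Lemma rect_dim_le_node tau : A tau -> rect_dim delta kappa a t * tau <= F tau.
Proof.
move=> Atau; have tau0 := node_gt0 Atau.
rewrite -dim_atE// ler_pM2r//; apply: ge_inf; last by exists tau.
by exists 0 => _ [? ? <-]; exact: dim_at_ge0.
Qed.

Lemma rect_dim_le_sum : rect_dim delta kappa a t <= \sum_i delta i.
Proof.
have A0 : A (a (Ordinal d_gt0)) by left; eexists.
rewrite -(ler_pM2r (node_gt0 A0)) (le_trans (rect_dim_le_node A0))// mulr_suml.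
by apply: ler_sum => i _; rewrite exponent1_le_lin// ltW.
Qed.

(* [exponent] is affine between consecutive points of [A] and, past the last
   one, has slope [\sum_i delta i]; it vanishes at 0. *)
Lemma rect_dim_le_exponent tau : 0 <= tau ->
  rect_dim delta kappa a t * tau <= F tau.
Proof.
move=> tau0; set s := rect_dim _ _ _ _.
(* Adding 0 guarantees a node below every [tau >= 0]. *)
pose nodes := [:: 0 & [seq a i | i : 'I_d] ++ [seq a i + t i | i : 'I_d]].
have nodesP x : x \in nodes -> 0 <= x /\ s * x <= F x.
  rewrite inE => /orP[/eqP->|].
    split=> //; rewrite mulr0; apply: sumr_ge0 => i _.
    by apply: exponent1_ge0 => //; rewrite ltW.
  by rewrite mem_cat => /orP[] /mapP[i _ ->]; (split; [rewrite ltW// ?addr_gt0//|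
    apply: rect_dim_le_node]); [left|right]; exists i.
have a_nodes i : a i \in nodes.
  by rewrite inE mem_cat map_f ?orbT// mem_enum.
have at_nodes i : a i + t i \in nodes.
  by rewrite inE mem_cat (map_f (fun i => a i + t i)) ?orbT// mem_enum.
pose p := \big[Num.max/0]_(x <- nodes | x <= tau) x.
have [p_nodes ptau] : p \in nodes /\ p <= tau.
  rewrite /p big_seq_cond; elim/big_ind: _ => [|x y [? ?] [? ?]|x /andP[]//].
    by rewrite inE eqxx.
  by case: (leP x y).
have p_max x : x \in nodes -> x <= tau -> x <= p.
  by move=> xn xt; rewrite /p; apply: le_bigmax_seq.
have [_ sp] := nodesP _ p_nodes.
(* Beyond the last node, the bound at [p] propagates because the slope is at least [rect_dim], by
   [rect_dim_le_sum]. *)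
have [/hasP[q0 q0_nodes tq0]|/hasPn no_node] := boolP (has (>= tau) nodes); last first.
  have -> : F tau = F p + (\sum_i delta i) * (tau - p).
    rewrite mulr_suml -big_split/=; apply: eq_bigr => i _.
    apply: exponent1_affine_end => //; apply: p_max => //.
    by have := no_node _ (at_nodes i); rewrite -ltNge => /ltW.
  by have := rect_dim_le_sum; rewrite -/s => ?; nra.
(* The default value [q0] is itself a node above [tau], so the minimum is one too. *)
pose q := \big[Num.min/q0]_(x <- nodes | tau <= x) x.
have [q_nodes tq] : q \in nodes /\ tau <= q.
  rewrite /q big_seq_cond; elim/big_ind: _ => [//|x y [? ?] [? ?]|x /andP[]//].
  by case: (leP x y).
have q_min x : x \in nodes -> tau <= x -> q <= x.
  by move=> xn xt; rewrite /q; apply: ge_bigmin_seq.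
have [_ sq] := nodesP _ q_nodes.
have E : F tau * (q - p) = F p * (q - tau) + F q * (tau - p).
  rewrite !mulr_suml -big_split/=; apply: eq_bigr => i _.
  apply: exponent1_affine => //.
    case: (leP (a i) tau) => h; first by rewrite p_max.
    by rewrite q_min ?orbT// ltW.
  case: (leP (a i + t i) tau) => h; first by rewrite p_max.
  by rewrite q_min ?orbT// ltW.
(* The bounds at [p] and [q] pass to the affine interpolant. If [q <= p], then [tau] is the node
   [p]. *)
have [pq|qp] := ltP p q; first by rewrite -(ler_pM2r (_ : 0 < q - p)) ?subr_gt0// E; nra.
by have -> : tau = p by lra.
Qed.

End rect_dim_bounds.

(** * Powers, products, and the dimension in multiplicative form *)

Section powR_products.
Context {R : realType} {d : nat}.

Lemma powRDp (x r s : R) : 0 < x -> x `^ (r + s) = x `^ r * x `^ s.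
Proof. by move=> x0; rewrite powRD// (gt_eqF x0) implybT. Qed.

Lemma powR_sum (x : R) (f : 'I_d -> R) : 0 < x ->
  x `^ (\sum_i f i) = \prod_i x `^ f i.
Proof.
move=> x0; apply: (big_morph (powR x)); last by rewrite powRr0.
by move=> r s; exact: powRDp.
Qed.

Lemma powR_le (r x y : R) : 0 <= r -> 0 <= x -> x <= y -> x `^ r <= y `^ r.
Proof.
move=> r0 x0 xy; apply: ge0_ler_powR; rewrite ?nnegrE//.
exact: le_trans xy.
Qed.

Lemma powR_lt (r x y : R) : 0 < r -> 0 <= x -> x < y -> x `^ r < y `^ r.
Proof.
move=> r0 x0 xy; apply: gt0_ltr_powR; rewrite ?nnegrE//.
exact: le_trans (ltW xy).
Qed.

Lemma powR_max (x r s : R) : 0 < x <= 1 ->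
  Num.max (x `^ r) (x `^ s) = x `^ (Num.min r s).
Proof.
move=> x01; case: (leP r s) => rs; first by rewrite max_l// ger_powR.
by rewrite max_r// ger_powR// ltW.
Qed.

Lemma powR_min (x r s : R) : 0 < x <= 1 ->
  Num.min (x `^ r) (x `^ s) = x `^ (Num.max r s).
Proof.
move=> x01; case: (leP r s) => rs; first by rewrite min_r// ger_powR.
by rewrite min_l// ger_powR// ltW.
Qed.

(** Write [h] as [rho ^ tau]. Since [rho < 1], maxima of powers become minima of exponents and
    conversely, so the left side is the last product times [rho ^ exponent tau], and
    [rect_dim_le_exponent] bounds this power by [h ^ T]. The left side is the shape of the mass of
    shrunken rectangles in a ball of radius [h]. *)
Lemma rect_dim_scale (delta kappa a t : 'I_d -> R) (rho h T : R) :
  (0 < d)%N -> (forall i, 0 < delta i) ->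
  (forall i, 0 <= kappa i) -> (forall i, kappa i < 1) ->
  (forall i, 0 < a i) -> (forall i, 0 < t i) ->
  0 < rho < 1 -> 0 < h <= 1 -> T <= rect_dim delta kappa a t ->
  \prod_i (Num.max (rho `^ a i) h `^ delta i
     * (Num.min (rho `^ (a i + t i)) h `^ (delta i * (1 - kappa i))
        * Num.min (rho `^ a i) h `^ (delta i * kappa i)))
  <= h `^ T * \prod_i ((rho `^ (a i + t i)) `^ (delta i * (1 - kappa i))
        * (rho `^ a i) `^ (delta i * kappa i)).
Proof.
move=> d0 de0 ka0 ka1 a0 t0 /andP[r0 r1] /andP[h0 h1] Tle.
have rho01 : 0 < rho <= 1 by rewrite r0 ltW.
have lnr : ln rho < 0 by rewrite ln_lt0// r0.
pose tau := ln h / ln rho.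
have hE : h = rho `^ tau.
  by rewrite /powR gt_eqF// /tau mulfVK ?lt_eqF// lnK.
have tau0 : 0 <= tau by rewrite /tau -mulrNN -invrN divr_ge0// ?oppr_ge0 ?ln_le0// ltW.
rewrite hE; under eq_bigr => i _.
  rewrite powR_max// !powR_min// -!powRrM -!powRDp//.
  have -> : Num.min (a i) tau * delta i +
     (Num.max (a i + t i) tau * (delta i * (1 - kappa i)) +
      Num.max (a i) tau * (delta i * kappa i)) =
      exponent1 (delta i) (kappa i) (a i) (t i) tau +
      ((a i + t i) * (delta i * (1 - kappa i)) + a i * (delta i * kappa i)).
    by rewrite /exponent1 (minC tau) (maxC tau (a i)) (maxC tau (_ + _)); ring.
  rewrite powRDp//.
over.
under [X in _ <= _ * X]eq_bigr do rewrite -!powRrM -powRDp//.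
rewrite big_split/= ler_wpM2r//.
  by apply: prodr_ge0 => i _; exact: powR_ge0.
rewrite -powRrM -powR_sum// ger_powR//.
rewrite (le_trans _ (rect_dim_le_exponent d0 de0 ka0 ka1 a0 t0 tau0))//.
by rewrite mulrC ler_wpM2r.
Qed.

End powR_products.

Lemma le_prode {R : realType} {d : nat} (e f : 'I_d -> \bar R) :
  (forall i, 0 <= e i)%E -> (forall i, e i <= f i)%E ->
  (\prod_i e i <= \prod_i f i)%E.
Proof.
move=> e0 ef.
suff /andP[] : (0 <= \prod_i e i)%E && (\prod_i e i <= \prod_i f i)%E by [].
elim/big_rec2 : _ => [|i x y _ /andP[y0 yx]]; first by rewrite lee01 lexx.
by rewrite mule_ge0//= lee_pmul.
Qed.

(** A longest admissible sequence works: a point of [A] in relation [e] with all its members could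
    be put in front of it. *)
Lemma max_pairwise (T : eqType) (A : set T) (e : rel T) (N : nat) :
  (forall s : seq T, (forall z, z \in s -> A z) -> pairwise e s ->
    (size s <= N)%N) ->
  exists s : seq T, [/\ forall z, z \in s -> A z, pairwise e s &
    forall x, A x -> exists2 z, z \in s & ~~ e x z].
Proof.
move=> sN.
pose P n := `[< exists s : seq T,
  [/\ forall z, z \in s -> A z, pairwise e s & size s = n] >].
have P0 : exists n, P n by exists 0%N; apply/asboolP; exists [::].
have PN n : P n -> (n <= N)%N by move=> /asboolP[s [sA se <-]]; exact: sN.
case: (ex_maxnP P0 PN) => n /asboolP[s [sA se sn]] nmax.
exists s; split => // x Ax; apply/hasP; rewrite -[has _ _]negbK; apply/negP.
rewrite -all_predC => sx.
suff /nmax : P n.+1 by rewrite ltnn.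
apply/asboolP; exists (x :: s); split=> /=; last by rewrite sn.
  by move=> z; rewrite inE => /orP[/eqP->//|]; exact: sA.
rewrite se andbT; apply/allP => z zs.
by have /allP/(_ z zs)/= := sx; rewrite negbK.
Qed.

(** * Balls, boxes and product measures *)

Section metric_misc.
Context {R : realType}.

Lemma mdistC (T : metricType R) (x y : T) : mdist x y = mdist y x.
Proof. exact: metric_sym. Qed.

Lemma ballP (T : metricType R) (x y : T) (h : R) : ball x h y <-> mdist x y < h.
Proof. by rewrite ballEmdist. Qed.

Lemma ball_openT (T : metricType R) (x : T) (h : R) : open (ball x h).
Proof.
rewrite openE => y /ballP xy; apply/nbhs_ballP; exists (h - mdist x y) => /=.
  by rewrite subr_gt0.
move=> z /ballP yz; apply/ballP.
by rewrite (le_lt_trans (metric_triangle _ y _))// -ltrBrDl.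
Qed.

Lemma nbhd_open (T : metricType R) (A : set T) (h : R) : open (nbhd A h).
Proof. by apply: bigcup_open => x _; exact: ball_openT. Qed.

Lemma open_measurable_borel (T : pmetricType R) (A : set T) :
  open A -> measurable (A : set (borelType T)).
Proof. by move=> oA; exact: sub_sigma_algebra. Qed.

Lemma mdist_le_diam (T : metricType R) (x : T) (h : R) (p q : T) :
  ball x h p -> ball x h q -> mdist p q <= diam (ball x h).
Proof.
move=> xp xq; apply: ub_le_sup; last by exists (p, q).
exists (h + h) => _ [[a b] [/= /ballP xa /ballP xb] <-].
by rewrite (le_trans (metric_triangle _ x _))// lerD// ?(mdistC a) ltW.
Qed.

Lemma diam_ball_ge0 (T : metricType R) (x : T) (h : R) : 0 < h ->
  0 <= diam (ball x h).
Proof.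
move=> h0; rewrite -(mdistxx x); apply: (@mdist_le_diam _ _ _ x x);
  by apply/ballP; rewrite mdistxx.
Qed.

Lemma diam_ball_le (T : metricType R) (x : T) (h : R) : 0 < h ->
  diam (ball x h) <= 2 * h.
Proof.
move=> h0; apply: sup_le_ub.
  by exists (mdist x x), (x, x) => //; split; apply/ballP; rewrite mdistxx.
move=> _ [[a b] [/= /ballP xa /ballP xb] <-].
by rewrite (le_trans (metric_triangle _ x _))// mulr2n mulrDl !mul1r lerD// ?(mdistC a) ltW.
Qed.

End metric_misc.

Section boxes.
Context {R : realType} {d : nat} (X : 'I_d -> pmetricType R).
Implicit Types (A B : forall i, set (X i)) (x y z : maxprod X) (q : 'I_d -> R).

Definition box A : set (maxprod X) := [set x | forall i, A i (x i)].

Definition cube z q : set (maxprod X) := box (fun i => ball (z i) (q i)).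

Lemma box_open A : (forall i, open (A i)) -> open (box A).
Proof.
move=> oA; rewrite openE => x Ax; apply: (@filter_forall _ 'I_d (fun i (y : maxprod X) => A i (y i)) (nbhs x)) => i.
have /nbhs_ballP[e /= e0 eA] : nbhs (x i) (A i) by apply: open_nbhs_nbhs; split.
apply/nbhs_ballP; exists e => //= y /ballP xy; apply: eA; apply/ballP.
by rewrite (le_lt_trans _ xy)// maxdist_ge.
Qed.

Lemma ball_cube x (h : R) : 0 < h -> ball x h = cube x (fun=> h).
Proof.
move=> h0; apply/seteqP; split => [y /ballP xy i|y xy].
  by apply/ballP; rewrite (le_lt_trans _ xy)// maxdist_ge.
apply/ballP; apply/bigmax_ltP; split=> // i _.
by apply/ballP; exact: xy.
Qed.

End boxes.

Section product_measure.
Context {R : realType} {d : nat} (X : 'I_d -> pmetricType R).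
Context (m : forall i, {measure set (borelType (X i)) -> \bar R})
  (mX : {measure set (borelType (maxprod X)) -> \bar R})
  (mXE : is_product_measure m mX).

Lemma measure_box (A : forall i, set (X i)) : (forall i, open (A i)) ->
  mX (box A) = (\prod_i m i (A i))%E.
Proof. by move=> oA; apply: mXE => i; exact: open_measurable_borel. Qed.

Lemma measure_box_le (A : forall i, set (X i)) (hi : 'I_d -> R) :
  (forall i, open (A i)) -> (forall i, m i (A i) <= (hi i)%:E)%E ->
  (mX (box A) <= (\prod_i hi i)%:E)%E.
Proof. by move=> oA mA; rewrite measure_box// -prodEFin le_prode. Qed.

Lemma measure_box_ge (A : forall i, set (X i)) (lo : 'I_d -> R) :
  (forall i, open (A i)) -> (forall i, 0 <= lo i) ->
  (forall i, (lo i)%:E <= m i (A i))%E ->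
  ((\prod_i lo i)%:E <= mX (box A))%E.
Proof. by move=> oA lo0 mA; rewrite measure_box// -prodEFin le_prode. Qed.

End product_measure.

(** * Counting by covering and by packing *)

Section packing.
Context {disp : measure_display} {R : realType} {T : measurableType disp}
  (mu : {measure set T -> \bar R}) {I : eqType} (Q : I -> set T).

Lemma measure_seq_le (s : seq I) (V : set T) (b : R) :
  measurable V -> (forall z, z \in s -> measurable (Q z)) ->
  (forall x, V x -> exists2 z, z \in s & Q z x) ->
  (forall z, z \in s -> mu (Q z) <= b%:E)%E -> (mu V <= ((size s)%:R * b)%:E)%E.
Proof.
elim: s V => [|z s IH] V mV mQ VQ Qb.
  have -> : V = set0 by rewrite -subset0 => x /VQ[].
  by rewrite measure0 mul0r.
have mz : measurable (Q z) by apply: mQ; rewrite mem_head.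
have -> : V = (V `&` Q z) `|` (V `\` Q z) by rewrite setUIDK.
rewrite (le_trans (measureU2 _ _ _))//; [exact: measurableI|exact: measurableD|].
rewrite /= -nat1r mulrDl mul1r EFinD leeD//.
  rewrite (le_trans _ (Qb z _)) ?mem_head// le_measure ?inE//; exact: measurableI.
apply: IH.
- exact: measurableD.
- by move=> y ys; apply: mQ; rewrite inE ys orbT.
- move=> x [/VQ[y]]; rewrite inE => /orP[/eqP-> //|ys Qyx _]; by exists y.
- by move=> y ys; apply: Qb; rewrite inE ys orbT.
Qed.

Lemma measure_seq_ge (s : seq I) (V : set T) (b : R) (e : rel I) :
  measurable V -> (forall z, z \in s -> measurable (Q z)) ->
  (forall z, z \in s -> Q z `<=` V) ->
  (forall z z', e z z' -> Q z `&` Q z' = set0) -> pairwise e s ->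
  (forall z, z \in s -> b%:E <= mu (Q z))%E -> (((size s)%:R * b)%:E <= mu V)%E.
Proof.
elim: s V => [|z s IH] V mV mQ VQ eQ /=; first by rewrite mul0r measure_ge0.
move=> /andP[ez es] Qb.
have mz : measurable (Q z) by apply: mQ; rewrite mem_head.
have -> : V = Q z `|` (V `\` Q z).
  by rewrite setDUK// => x; apply: VQ; rewrite mem_head.
rewrite measureU//; [|exact: measurableD|by rewrite setDIK].
rewrite /= -nat1r mulrDl mul1r EFinD leeD//; first by rewrite Qb ?mem_head.
apply: IH => //.
- exact: measurableD.
- by move=> y ys; apply: mQ; rewrite inE ys orbT.
- move=> y ys x Qyx; split; first by apply: (VQ y) => //; rewrite inE ys orbT.
  move=> Qzx; have /allP/(_ _ ys)/eQ := ez.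
  by rewrite -subset0 => /(_ x); apply.
- by move=> y ys; apply: Qb; rewrite inE ys orbT.
Qed.

End packing.

(** * Separated families of rectangles *)

Section separation.
Context {R : realType} {d : nat} (X : 'I_d -> pmetricType R).
Implicit Types (x y z : maxprod X) (q : 'I_d -> R).

(** The factor 4 makes even the doubled cubes disjoint, which leaves room for small sets that only
    meet the cubes. *)
Definition apart q z z' : bool := [exists i, 4 * q i <= mdist (z i) (z' i)].

Lemma apart_cubes q z z' : apart q z z' ->
  cube z (fun i => 2 * q i) `&` cube z' (fun i => 2 * q i) = set0.
Proof.
move=> /existsP[i qi]; rewrite -subset0 => y [/(_ i)/ballP zy /(_ i)/ballP z'y].
by have := metric_triangle (z i) (y i) (z' i); rewrite (mdistC (y i)); lra.
Qed.

Lemma napartP q z z' : ~~ apart q z z' -> cube z (fun i => 4 * q i) z'.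
Proof. by move=> /existsPn zz' i; apply/ballP; rewrite ltNge zz'. Qed.

Lemma apartC q z z' : apart q z z' = apart q z' z.
Proof. by apply: eq_existsb => i; rewrite mdistC. Qed.

Lemma cubeS q q' z : (forall i, q i <= q' i) -> cube z q `<=` cube z q'.
Proof.
by move=> qq' y zy i; apply/ballP; rewrite (lt_le_trans _ (qq' i))//; apply/ballP; exact: zy.
Qed.

Lemma cube_open z q : open (cube z q).
Proof. by apply: box_open => i; exact: ball_openT. Qed.

End separation.

(** * Sums over countable families *)

Section esum_lemmas.
Context {R : realType} {T : choiceType} (f : T -> \bar R).
Context (f_ge0 : forall k, (0 <= f k)%E).

Lemma subset_esum (A B : set T) : A `<=` B ->
  (\esum_(k in A) f k <= \esum_(k in B) f k)%E.
Proof.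
move=> AB; rewrite [leRHS](esumID A)//.
have -> : B `&` A = A by rewrite setIC; apply/setIidPl.
by rewrite leeDl// esum_ge0.
Qed.

(** The counterpart of [measure_seq_ge] for the measure with weights [f]. *)
Lemma esum_seq_ge {I : eqType} (Q : I -> set T) (s : seq I) (V : set T) (b : R)
    (e : rel I) :
  (forall z, z \in s -> Q z `<=` V) ->
  (forall z z', e z z' -> Q z `&` Q z' = set0) -> pairwise e s ->
  (forall z, z \in s -> b%:E <= \esum_(k in Q z) f k)%E ->
  (((size s)%:R * b)%:E <= \esum_(k in V) f k)%E.
Proof.
elim: s V => [|z s IH] V VQ eQ /=; first by rewrite mul0r esum_ge0.
move=> /andP[ez es] Qb; rewrite (esumID (Q z))//.
have -> : V `&` Q z = Q z by rewrite setIC; apply/setIidPl; apply: VQ; rewrite mem_head.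
rewrite /= -nat1r mulrDl mul1r EFinD leeD//; first by rewrite Qb ?mem_head.
apply: IH => //.
- move=> y ys x Qyx; split; first by apply: (VQ y) => //; rewrite inE ys orbT.
  move=> Qzx; have /allP/(_ _ ys)/eQ := ez.
  by rewrite -subset0 => /(_ x); apply.
- by move=> y ys; apply: Qb; rewrite inE ys orbT.
Qed.

Lemma esum_term_le (A : set T) (k : T) : A k -> (f k <= \esum_(k in A) f k)%E.
Proof.
move=> Ak; rewrite -(esum_set1 (f_ge0 k)); apply: subset_esum.
by move=> _ ->.
Qed.

(** The total is the supremum of the finite partial sums, and [F] indexes one within [e] of it. *)
Lemma esum_tail_small (A : set T) (e : R) : 0 < e ->
  (\esum_(k in A) f k < +oo)%E ->
  exists2 F : set T, finite_set F /\ F `<=` A &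
    (\esum_(k in A `\` F) f k <= e%:E)%E.
Proof.
move=> e0 Aoo; have A0 : (0 <= \esum_(k in A) f k)%E by exact: esum_ge0.
have Afin : (\esum_(k in A) f k)%E \is a fin_num by rewrite ge0_fin_numE.
have [_ [F [finF FA] <-] FAe] : exists2 y,
    [set (\sum_(k \in F) f k)%E | F in fsets A] y & (\esum_(k in A) f k - e%:E < y)%E.
  by apply: ereal_sup_gt; rewrite lteBlDr// lteDl// lte_fin.
exists F => //; move: FAe; rewrite -esum_fset// (esumID F A)//.
have -> : A `&` F = F by rewrite setIC; apply/setIidPl.
have Ffin : (\esum_(k in F) f k)%E \is a fin_num.
  rewrite ge0_fin_numE ?esum_ge0//; apply: le_lt_trans Aoo; exact: subset_esum.
have Dfin : (\esum_(k in A `\` F) f k)%E \is a fin_num.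
  rewrite ge0_fin_numE ?esum_ge0//; apply: le_lt_trans Aoo.
  by apply: subset_esum => x [].
rewrite -setDE; move: (\esum_(k in A `\` F) f k)%E Dfin => [y| |]// _.
move: (\esum_(k in F) f k)%E Ffin => [x| |]// _.
by rewrite -EFinD -EFinB lte_fin lee_fin => ?; lra.
Qed.

End esum_lemmas.

(** * Packings and nets in an Ahlfors regular product *)

Section regular_product.
Context {R : realType} {d : nat} (X : 'I_d -> pmetricType R).
Context (m : forall i, {measure set (borelType (X i)) -> \bar R})
  (mX : {measure set (borelType (maxprod X)) -> \bar R})
  (mXE : is_product_measure m mX)
  (delta : 'I_d -> R)
  (K r1 : R) (K_ge1 : 1 <= K)
  (ball_reg : forall i (x : X i) h, 0 < h -> h < r1 ->
    comparable_up_to K (h `^ delta i) (m i (ball x h))).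
Implicit Types (x y z : maxprod X) (q : 'I_d -> R).

Local Notation D := (\sum_i delta i).

Let K_gt0 : 0 < K. Proof. exact: lt_le_trans K_ge1. Qed.

Lemma measurable_cube z q : measurable (cube z q : set (borelType (maxprod X))).
Proof. by apply: open_measurable_borel; exact: cube_open. Qed.

Lemma measurable_ball_maxprod z h :
  measurable (ball z h : set (borelType (maxprod X))).
Proof. by apply: open_measurable_borel; exact: ball_openT. Qed.

Lemma prod_const (c : R) (f : 'I_d -> R) : \prod_i (c * f i) = c ^+ d * \prod_i f i.
Proof. by rewrite big_split/= prodr_const card_ord. Qed.

Lemma cube_ge z q : (forall i, 0 < q i < r1) ->
  ((K^-1 ^+ d * \prod_i q i `^ delta i)%:E <= mX (cube z q))%E.
Proof.
move=> q01; rewrite -prod_const; apply: (measure_box_ge mXE) => i.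
- exact: ball_openT.
- by rewrite mulr_ge0 ?powR_ge0// invr_ge0 ltW.
- by have /andP[q0 q1] := q01 i; have [] := ball_reg (z i) q0 q1.
Qed.

Lemma cube_le z q : (forall i, 0 < q i < r1) ->
  (mX (cube z q) <= (K ^+ d * \prod_i q i `^ delta i)%:E)%E.
Proof.
move=> q01; rewrite -prod_const; apply: (measure_box_le mXE) => i.
- exact: ball_openT.
- by have /andP[q0 q1] := q01 i; have [] := ball_reg (z i) q0 q1.
Qed.

Lemma ball_ge z h : 0 < h < r1 -> ((K^-1 ^+ d * h `^ D)%:E <= mX (ball z h))%E.
Proof.
by move=> /andP[h0 h1]; rewrite powR_sum// ball_cube// cube_ge// => i; rewrite h0.
Qed.

Lemma ball_le z h : 0 < h < r1 -> (mX (ball z h) <= (K ^+ d * h `^ D)%:E)%E.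
Proof.
by move=> /andP[h0 h1]; rewrite powR_sum// ball_cube// cube_le// => i; rewrite h0.
Qed.

(** The cubes are disjoint, and [cube_ge] bounds the mass of each from below. *)
Lemma packing_cubes q (s : seq (maxprod X)) (V : set (maxprod X)) (v : R) :
  (forall i, 0 < q i < r1) ->
  measurable (V : set (borelType (maxprod X))) -> (mX V <= v%:E)%E ->
  (forall z, z \in s -> cube z q `<=` V) -> pairwise (apart q) s ->
  (size s)%:R * (K^-1 ^+ d * \prod_i q i `^ delta i) <= v.
Proof.
move=> q01 mV Vv sV sq; rewrite -lee_fin (le_trans _ Vv)//.
apply: (@measure_seq_ge _ _ _ mX _ (fun z => cube z q) s V _ (apart q)) => //.
- by move=> z _; exact: measurable_cube.
- move=> z z' /apart_cubes zz'; rewrite -subset0 -zz'.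
  by apply: setISS; apply: cubeS => i; have /andP[] := q01 i => *; lra.
- by move=> z _; exact: cube_ge.
Qed.

(** [packing_cubes] bounds the size of separated families in [A], so a maximal one exists; by
    maximality its fourfold cubes cover [A]. *)
Lemma exists_net q (A V : set (maxprod X)) (v : R) :
  (forall i, 0 < q i < r1) ->
  measurable (V : set (borelType (maxprod X))) -> (mX V <= v%:E)%E ->
  (forall z, A z -> cube z q `<=` V) ->
  exists s : seq (maxprod X), [/\ forall z, z \in s -> A z,
    pairwise (apart q) s &
    forall x, A x -> exists2 z, z \in s & cube z (fun i => 4 * q i) x].
Proof.
move=> q01 mV Vv AV.
set b := K^-1 ^+ d * \prod_i q i `^ delta i.
have b0 : 0 < b.
  rewrite mulr_gt0 ?exprn_gt0 ?invr_gt0//; apply: prodr_gt0 => i _.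
  by apply: powR_gt0; have /andP[] := q01 i.
have [s [sA sq As]] : exists s : seq (maxprod X), [/\ forall z, z \in s -> A z,
    pairwise (apart q) s & forall x, A x -> exists2 z, z \in s & ~~ apart q x z].
  apply: (@max_pairwise _ _ _ (Num.truncn (v / b))) => s sA sq.
  rewrite truncn_ge_nat; last first.
    by rewrite divr_ge0 ?(ltW b0)// -lee_fin (le_trans _ Vv).
  by rewrite ler_pdivlMr//; apply: (packing_cubes q01 mV Vv) => // z /sA /AV.
exists s; split => // x /As[z zs]; rewrite apartC => /napartP xz; by exists z.
Qed.

End regular_product.

(** * Selecting a ball that meets little of a cover *)

Section pigeonhole.
Context {R : realType} {d : nat} (X : 'I_d -> pmetricType R).
Context (m : forall i, {measure set (borelType (X i)) -> \bar R})
  (mX : {measure set (borelType (maxprod X)) -> \bar R})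
  (mXE : is_product_measure m mX)
  (delta : 'I_d -> R)
  (K r1 : R) (K_ge1 : 1 <= K)
  (ball_reg : forall i (x : X i) h, 0 < h -> h < r1 ->
    comparable_up_to K (h `^ delta i) (m i (ball x h))).
Context (I : set nat) (y : nat -> maxprod X) (h : nat -> R)
  (h_gt0 : forall k, I k -> 0 < h k) (T : R).

Definition covering k : set (maxprod X) := ball (y k) (h k).
Definition weight k : \bar R := (diam (covering k) `^ T)%:E.

Local Notation U := covering.
Local Notation wt := weight.

Definition meeting (z : maxprod X) (e : R) : set nat :=
  [set k | I k /\ U k `&` ball z e !=set0].

Definition larger (e : R) : set nat := [set k | I k /\ e < diam (U k)].
Definition smaller (e : R) : set nat := [set k | I k /\ diam (U k) <= e].

Lemma weight_ge0 k : (0 <= wt k)%E.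
Proof. by rewrite lee_fin powR_ge0. Qed.

Lemma meeting_near z e k p : 0 < h k -> U k p -> ball z e p -> forall p', U k p' ->
  mdist z p' < e + diam (U k).
Proof.
move=> hk Up /ballP zp p' Up'.
by rewrite (le_lt_trans (metric_triangle _ p _))// ltr_leD// mdist_le_diam.
Qed.

Lemma measure_bigcup_le (P : set (maxprod X)) (B : set nat)
    (F : nat -> set (maxprod X)) (g : nat -> R) :
  measurable (P : set (borelType (maxprod X))) ->
  (forall k, measurable (F k : set (borelType (maxprod X)))) ->
  (forall k, 0 <= g k) ->
  (forall k, B k -> (mX (P `&` F k) <= (g k)%:E)%E) ->
  (mX (P `&` \bigcup_(k in B) F k) <= \esum_(k in B) (g k)%:E)%E.
Proof.
move=> mP mF g0 PF.
(* Empty sets outside [B] allow countable subadditivity over all naturals. *)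
pose G k := if k \in B then P `&` F k else set0.
have mG k : measurable (G k : set (borelType (maxprod X))).
  by rewrite /G; case: ifP => _ //; exact: measurableI.
have PG : P `&` \bigcup_(k in B) F k `<=` \bigcup_k G k.
  by move=> x [Px [k Bk Fx]]; exists k => //; rewrite /G mem_set.
rewrite (le_trans (measure_sigma_subadditive mX mG _ PG))//.
  by apply: measurableI => //; exact: bigcup_measurable.
rewrite nneseries_esumT// [leRHS]esum_mkcond; apply: le_esum => k _.
rewrite /G; case: ifPn => [/set_mem Bk|_]; last by rewrite measure0.
exact: PF.
Qed.

(* Each [U k] of diameter at most [rho0] meets at most one ball of radius [rho0]
   centred in a [4 rho0]-separated set: the sum over such [U k] splits. *)
Lemma pigeonhole (P V : set (maxprod X)) (v A q M S rho0 : R) :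
  measurable (P : set (borelType (maxprod X))) ->
  measurable (V : set (borelType (maxprod X))) -> (mX V <= v%:E)%E ->
  0 < rho0 -> 4 * rho0 <= r1 / 4 ->
  (forall z, P z -> ball z rho0 `<=` V) ->
  0 < A -> 0 < M -> 0 < S ->
  (forall z e, 0 < e -> e <= r1 / 4 -> (mX (P `&` ball z e) <= (A * e `^ q)%:E)%E) ->
  (forall k, I k -> rho0 < diam (U k) -> 2 * diam (U k) <= r1 / 4) ->
  (M%:E <= mX P)%E ->
  (\esum_(k in larger rho0)
     (A * (2 * diam (U k)) `^ q)%:E <= (M / 2)%:E)%E ->
  (\esum_(k in smaller rho0) wt k <= S%:E)%E ->
  exists2 x, P x &
    (\esum_(k in meeting x rho0) wt k <= (S * (4 * A * (4 * rho0) `^ q / M))%:E)%E.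
Proof.
move=> mP mV Vv rho00 rho01 PV A0 M0 S0 frost bigr MP bigs smalls.
set big := larger rho0.
pose F k := ball (y k) (2 * diam (U k)).
(* Removing the enlarged large members costs at most half of the mass of [P]. *)
pose G := P `\` \bigcup_(k in big) F k.
have mF k : measurable (F k : set (borelType (maxprod X))).
  exact: measurable_ball_maxprod.
have mbF : measurable (\bigcup_(k in big) F k : set (borelType (maxprod X))).
  exact: bigcup_measurable.
have mG : measurable (G : set (borelType (maxprod X))) by exact: measurableD.
have GM : ((M / 2)%:E <= mX G)%E.
  have : (mX P <= mX G + (M / 2)%:E)%E.
    have {1}-> : P = G `|` (P `&` \bigcup_(k in big) F k).
      by rewrite /G setUC setUIDK.
    rewrite (le_trans (measureU2 _ _ _))//; first exact: measurableI.
    rewrite leeD2l// (le_trans _ bigs)//; apply: measure_bigcup_le => //.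
      by move=> k; rewrite mulr_ge0 ?powR_ge0// ltW.
    move=> k [Ik dk]; apply: frost; last exact: bigr.
    by rewrite mulr_gt0// (lt_trans rho00).
  move=> /(le_trans MP); case: (mX G) => [g| |]//=; last by move=> _; exact: leey.
  by rewrite -EFinD !lee_fin => ?; lra.
(* If a large [U k] met the ball, then [x] would lie within [rho0 + diam (U k) < 2 * diam (U k)] of
   its centre, hence in [F k]. *)
have small_meet x k : G x -> meeting x rho0 k -> diam (U k) <= rho0.
  move=> [Px nbx] [Ik [p [Up xp]]]; rewrite leNgt; apply/negP => dk.
  apply: nbx; exists k => //; apply/ballP; rewrite mdistC.
  have : U k (y k) by apply/ballP; rewrite mdistxx; exact: h_gt0.
  move=> /(meeting_near (h_gt0 Ik) Up xp); lra.
have rho0r : 0 < rho0 < r1 by rewrite rho00/=; lra.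
have [s [sG sq Gs]] : exists s : seq (maxprod X), [/\ forall z, z \in s -> G z,
    pairwise (apart (fun=> rho0)) s &
    forall x, G x -> exists2 z, z \in s & cube z (fun=> 4 * rho0) x].
  apply: (exists_net mXE K_ge1 ball_reg (q := fun=> rho0) (fun=> rho0r) mV Vv).
  by move=> z [Pz _]; rewrite -ball_cube//; exact: PV.
set g := A * (4 * rho0) `^ q.
have r40 : 0 < 4 * rho0 by rewrite mulr_gt0.
have g0 : 0 < g by rewrite mulr_gt0// powR_gt0.
(* The balls of radius [4 * rho0] around the net cover [G], and each carries mass at most [g] of
   [P]: the net has many points. *)
have Mg : M / 2 <= (size s)%:R * g.
  rewrite -lee_fin (le_trans GM)//.
  apply: (@measure_seq_le _ _ _ mX _ (fun z => P `&` ball z (4 * rho0))) => //.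
  - by move=> z _; apply: measurableI => //; exact: measurable_ball_maxprod.
  - move=> x Gx; have [z zs xz] := Gs _ Gx; exists z => //.
    by split; [case: Gx|rewrite ball_cube].
  - by move=> z _; exact: frost.
apply: contrapT => /forall2NP noP.
set b := S * (4 * A * (4 * rho0) `^ q / M).
(* If every point of the net failed, the disjoint index sets below would each contribute at least
   [b]. *)
have : (((size s)%:R * b)%:E <= S%:E)%E.
  apply: le_trans smalls; apply: (esum_seq_ge weight_ge0
    (Q := fun z => meeting z rho0 `&` smaller rho0) (e := apart (fun=> rho0))) => //.
  (* A small [U k] meeting the balls of [z] and [z'] would have a point within [2 * rho0] of both
     centres. *)
  - by move=> z z' /apart_cubes; rewrite -!subset0 -!ball_cube ?mulr_gt0// =>
      zz' k [[[Ik [p [Up zp]]] [_ dk]] [[_ [p' [Up' zp']]] _]];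
      apply: (zz' p); split; apply/ballP;
      [move/ballP: zp; lra|have := meeting_near (h_gt0 Ik) Up' zp' Up; lra].
  - move=> z zs; have [//|/negP] := noP z; first by case: (sG z zs).
    rewrite -ltNge => /ltW/le_trans; apply; apply: subset_esum; first exact: weight_ge0.
    move=> k zk; split => //; split; first by case: zk.
    by apply: (small_meet z) => //; exact: sG.
rewrite lee_fin; apply/negP; rewrite -ltNge.
(* By [Mg] the factor after [S] is at least 2, so the total exceeds [S]. *)
have -> : (size s)%:R * b = S * ((size s)%:R * g * 4 / M).
  by rewrite /b /g; ring.
by rewrite ltr_pMr// ltr_pdivlMr//; lra.
Qed.

End pigeonhole.

(** * The restricted measure at one level *)

Section layer.
Context {R : realType} {d : nat} (X : 'I_d -> pmetricType R).
Context (m : forall i, {measure set (borelType (X i)) -> \bar R})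
  (mX : {measure set (borelType (maxprod X)) -> \bar R})
  (mXE : is_product_measure m mX)
  (delta : 'I_d -> R) (delta_gt0 : forall i, 0 < delta i)
  (kappa : 'I_d -> R) (kappa_ge0 : forall i, 0 <= kappa i)
  (kappa_lt1 : forall i, kappa i < 1)
  (K r1 : R) (K_ge1 : 1 <= K) (r1_le1 : r1 <= 1)
  (ball_reg : forall i (x : X i) h, 0 < h -> h < r1 ->
    comparable_up_to K (h `^ delta i) (m i (ball x h)))
  (J : Type) (Res : forall i, J -> set (X i)).
Arguments Res : clear implicits.
Context (nbhd_reg : forall i eta h alpha (x : X i), 0 < eta -> eta <= h -> h < r1 ->
    Res i alpha x ->
    comparable_up_to K
      (eta `^ (delta i * (1 - kappa i)) * h `^ (delta i * kappa i))
      (m i (ball x h `&` nbhd (Res i alpha) eta))).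

Local Notation D := (\sum_i delta i).

Let K_gt0 : 0 < K. Proof. exact: lt_le_trans K_ge1. Qed.

Lemma prod_powRM (c : R) (f : 'I_d -> R) : 0 < c -> (forall i, 0 <= f i) ->
  \prod_i (c * f i) `^ delta i = c `^ D * \prod_i f i `^ delta i.
Proof.
move=> c0 f0; rewrite powR_sum// -big_split/=; apply: eq_bigr => i _.
by rewrite powRM// ltW.
Qed.

(** There are three regimes. For [q <= h] the ball around [y] is ignored and scaling applies at [z].
    For [v <= h < q] scaling applies with radius [3 * h] at a nearby resonant point, whence the
    factor [3 ^ delta]. For [h < v] only the regularity of the ball around [y] is used. *)
Lemma resonant_local_le i alpha (z y : X i) (q v h : R) :
  0 < v -> v <= q -> q < r1 -> 0 < h -> 3 * h < r1 -> Res i alpha z ->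
  (m i (ball z q `&` nbhd (Res i alpha) (v / 2) `&` ball y h) <=
   (K * 3 `^ delta i * (Num.min v h `^ (delta i * (1 - kappa i))
      * Num.min q h `^ (delta i * kappa i)))%:E)%E.
Proof.
move=> v0 vq q1 h0 h1 Rz.
have de0 := delta_gt0 i; have ka0 := kappa_ge0 i; have ka1 := kappa_lt1 i.
have dk0 : 0 <= delta i * kappa i by rewrite mulr_ge0// ltW.
have p3 : 1 <= 3 `^ delta i :> R.
  by rewrite -[leLHS](powRr0 3) ler_powR ?ler1n// ltW.
have mm A : open A -> measurable (A : set (borelType (X i))).
  exact: open_measurable_borel.
have oS : open (ball z q `&` nbhd (Res i alpha) (v / 2) `&` ball y h).
  by apply: openI; [apply: openI; [exact: ball_openT|exact: nbhd_open]|exact: ball_openT].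
have Kle A : 0 <= A -> K * A <= K * 3 `^ delta i * A.
  by move=> A0; rewrite -mulrA ler_pM2l// ler_peMl.
have nbS : nbhd (Res i alpha) (v / 2) `<=` nbhd (Res i alpha) v.
  move=> p [w Rw /ballP wp]; exists w => //; apply/ballP; lra.
have [qh|hq] := leP q h.
  rewrite min_l ?(le_trans vq)//.
  have [_ /le_trans] := nbhd_reg v0 vq q1 Rz.
  move=> /(_ (K * 3 `^ delta i * (v `^ (delta i * (1 - kappa i)) * q `^ (delta i * kappa i)))%:E).
  move=> H; apply: le_trans (H _); last first.
    by rewrite lee_fin Kle// mulr_ge0 ?powR_ge0.
  rewrite le_measure ?inE//; [exact: mm|apply: mm; apply: openI; [exact: ball_openT|exact: nbhd_open]|].
  by move=> p [[zp np] _]; split => //; exact: nbS.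
have [vh|hv] := leP v h.
  (* The new centre [w] lies within [v / 2] of a point [p] of the ball around [y], so that ball is
     inside the ball of radius [3 * h] around [w]. *)
  have [/eqP->|/set0P[p [[_ [w Rw /ballP wp]] /ballP yp]]] := boolP
     (ball z q `&` nbhd (Res i alpha) (v / 2) `&` ball y h == set0).
    by rewrite measure0 lee_fin !mulr_ge0 ?powR_ge0// ltW.
  have h30 : 0 < 3 * h by lra.
  have v3h : v <= 3 * h by lra.
  have [_ le3] := nbhd_reg v0 v3h h1 Rw.
  apply: (le_trans (le_trans _ le3)).
    rewrite le_measure ?inE//; [exact: mm|apply: mm; apply: openI; [exact: ball_openT|exact: nbhd_open]|].
    move=> p' [[_ np'] /ballP yp']; split; last exact: nbS.
    apply/ballP; have := metric_triangle w p y; have := metric_triangle w y p'.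
    by rewrite (mdistC p y); lra.
  rewrite lee_fin -mulrA ler_pM2l// powRM ?(ltW h0)// [leRHS]mulrCA.
  rewrite ler_wpM2l ?powR_ge0// ler_wpM2r ?powR_ge0// ler_powR ?ler1n//.
  by nra.
have [_ leh] := ball_reg y h0 (ltac:(lra) : h < r1).
apply: (le_trans (le_trans _ leh)).
  by apply: le_measure; rewrite ?inE; [exact: mm|apply: mm; exact: ball_openT|move=> p' []].
rewrite -powRDp//.
have -> : delta i * (1 - kappa i) + delta i * kappa i = delta i by ring.
by rewrite lee_fin Kle// powR_ge0.
Qed.

Section construction.
Context (a t : 'I_d -> R) (a_gt0 : forall i, 0 < a i) (t_gt0 : forall i, 0 < t i)
  (rho r c : R) (rho_gt0 : 0 < rho) (rho_lt1 : rho < 1)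
  (r_gt0 : 0 < r) (r_le : r <= r1 / 8) (c_gt0 : 0 < c)
  (x : maxprod X) (L : set J) (alpha0 : J).

Local Notation q := (fun i => rho `^ a i).
Local Notation v := (fun i => rho `^ (a i + t i)).

Context (q_small : forall i, q i <= r / 8)
  (ubiq : ((c * (r / 4) `^ D)%:E <=
    mX (ball x (r / 4) `&` \bigcup_(alpha in L) rect_nbhd Res alpha rho a))%E).

Let q_gt0 i : 0 < q i. Proof. exact: powR_gt0. Qed.
Let v_gt0 i : 0 < v i. Proof. exact: powR_gt0. Qed.
Let v_le i : v i <= q i.
Proof. by apply: ger_powR; rewrite ?rho_gt0 ?ltW// ltrDl. Qed.
Let q_lt i : 0 < q i < r1.
Proof. by rewrite q_gt0/=; have /= := q_small i; have := r_gt0; have := r_le; lra. Qed.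

Lemma rect_nbhd_open alpha s b : open (rect_nbhd Res alpha s b).
Proof. by apply: (box_open (A := fun i => nbhd (Res i alpha) (s `^ b i))) => i; exact: nbhd_open. Qed.

(** Up to constants, [Q] is the mass of a cube with sides [q], and [V] below that of its part near
    the resonant set when its centre is resonant. *)
Let Q := \prod_i q i `^ delta i.
Let V := \prod_i (v i `^ (delta i * (1 - kappa i)) * q i `^ (delta i * kappa i)).
Let Q_gt0 : 0 < Q. Proof. by apply: prodr_gt0 => i _; rewrite powR_gt0. Qed.
Let V_gt0 : 0 < V. Proof. by apply: prodr_gt0 => i _; rewrite mulr_gt0// powR_gt0. Qed.

Definition resonant (z : maxprod X) alpha := L alpha /\ forall i, Res i alpha (z i).

(** Half the width [v] is used so that small balls centred in a piece stay in the shrunken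
    rectangle. *)
Definition piece (al : maxprod X -> J) (z : maxprod X) : set (maxprod X) :=
  box (fun i => ball (z i) (q i) `&` nbhd (Res i (al z)) (v i / 2)).

Lemma piece_open al z : open (piece al z).
Proof.
by apply: box_open => i; apply: openI; [exact: ball_openT|exact: nbhd_open].
Qed.

Lemma piece_cube al z : piece al z `<=` cube z q.
Proof. by move=> y zy i; have [] := zy i. Qed.

(** Take a maximal separated set of resonant points. A point of the set in [ubiq] is within [q] of a
    resonant point, itself within [4 * q] of the net, so cubes of sides [5 * q] cover that set and
    their number is bounded below. *)
Lemma resonant_net : exists (al : maxprod X -> J) (s : seq (maxprod X)),
  [/\ forall z, z \in s -> ball x (r / 2) z /\ resonant z (al z),
      pairwise (apart q) s &
      c * (r / 4) `^ D <= (size s)%:R * (K ^+ d * (5 `^ D * Q))].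
Proof.
have r0 := r_gt0; have r_le' := r_le.
(* At points that are not resonant, [alpha0] serves as a default index. *)
have /choice[al alP] : forall z : maxprod X, exists alpha,
    (exists alpha', resonant z alpha') -> resonant z alpha.
  move=> z.
  by have [[alpha za]|nz] := pselect (exists alpha, resonant z alpha);
    [exists alpha|exists alpha0].
pose Z := [set z | ball x (r / 2) z /\ exists alpha, resonant z alpha].
have r4 : 0 < r / 4 by lra.
have r8 : 0 < r / 8 by lra.
have [s [sZ sq Zs]] : exists s : seq (maxprod X), [/\ forall z, z \in s -> Z z,
    pairwise (apart q) s & forall z, Z z -> exists2 z', z' \in s & cube z' (fun i => 4 * q i) z].
  apply: (@exists_net _ _ _ _ _ mXE _ _ _ K_ge1 ball_reg q Z (ball x r) (K ^+ d * r `^ D)) => //.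
  - exact: measurable_ball_maxprod.
  - by apply: (ball_le mXE ball_reg); rewrite r_gt0/=; lra.
  - move=> z [/ballP xz _] y /cubeS zy.
    have /ballP {}zy : ball z (r / 8) y by rewrite ball_cube//; exact: zy.
    by apply/ballP; have := metric_triangle x z y; lra.
exists al, s; split => //.
  by move=> z /sZ[xz ez]; split => //; exact: alP.
rewrite -lee_fin (le_trans ubiq)//.
pose Qz (z : maxprod X) := cube z (fun i => 5 * q i).
have mU : measurable (ball x (r / 4) `&` \bigcup_(alpha in L) rect_nbhd Res alpha rho a
    : set (borelType (maxprod X))).
  apply: open_measurable_borel; apply: openI; first exact: ball_openT.
  by apply: bigcup_open => alpha _; exact: rect_nbhd_open.
apply: (@measure_seq_le _ _ _ mX _ Qz) => //.
- by move=> z _; exact: measurable_cube.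
- move=> y [/ballP xy [alpha La ya]].
  have zP i : exists w, Res i alpha w /\ ball w (q i) (y i).
    by have [w Rw wy] := ya i; exists w.
  (* A resonant point is assembled coordinate by coordinate, with the same [alpha] in every
     direction. *)
  pose z : maxprod X := fun i => projT1 (cid (zP i)).
  have Rz i : Res i alpha (z i) by have [] := projT2 (cid (zP i)).
  have zy : cube z q y by move=> i; have [] := projT2 (cid (zP i)).
  have /ballP zy8 : ball z (r / 8) y by rewrite ball_cube//; exact: cubeS zy.
  have Zz : Z z.
    split; last by exists alpha.
    by apply/ballP; have := metric_triangle x y z; rewrite (mdistC y); lra.
  have [z' z's z'z] := Zs _ Zz; exists z' => // i; apply/ballP.
  have /ballP h1 := z'z i; have /ballP h2 := zy i.
  by have := metric_triangle (z' i) (z i) (y i); lra.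
- move=> z _.
  rewrite (_ : 5 `^ D * Q = \prod_i (5 * q i) `^ delta i); last first.
    by rewrite prod_powRM// => j; exact: ltW.
  apply: (cube_le mXE ball_reg) => i; have /= := q_small i; have /= := q_gt0 i.
  by move=> *; apply/andP; split; lra.
Qed.

(** [P] is the union of the pieces at the net and [w = V / Q]. There are at least about [r ^ D / Q]
    pieces, each of mass about [V], which gives the lower bound. In a ball of radius [h], the number
    of pieces that meet it times the mass each can put there is controlled by [rect_dim_scale]. *)
Lemma layer_exists (T : R) : (0 < d)%N -> T <= rect_dim delta kappa a t ->
  exists (P : set (maxprod X)) (w rho0 : R),
  [/\ 0 < w, 0 < rho0 <= r / 16, open P, P `<=` ball x (3 * r / 4) &
  [/\ forall y, P y -> ball y rho0 `<=`
        \bigcup_(alpha in L) rect_nbhd Res alpha rho (fun i => a i + t i),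
      ((c * (K^-1 ^+ d) ^+ 2 * (40 `^ D)^-1 * r `^ D * w)%:E <= mX P)%E &
      forall y h, 0 < h -> h <= r1 / 4 ->
        (mX (P `&` ball y h) <= ((K ^+ d) ^+ 3 * 9 `^ D * w * h `^ T)%:E)%E]].
Proof.
have r0 := r_gt0; have r_le' := r_le.
move=> d0 Tle; have [al [s [sP sq cs]]] := resonant_net.
pose P : set (maxprod X) := \bigcup_(z in [set` s]) piece al z.
pose rho0 := \big[Num.min/r / 16]_i (v i / 2).
have P_open : open P by apply: bigcup_open => z _; exact: piece_open.
have mop (A : set (maxprod X)) : open A -> measurable (A : set (borelType (maxprod X))).
  exact: open_measurable_borel.
have Kd0 : 0 < K ^+ d by rewrite exprn_gt0.
have r8 : 0 < r / 8 by lra.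
have r16 : 0 < r / 16 by lra.
have piece_apart z z' : apart q z z' -> piece al z `&` piece al z' = set0.
  move=> /apart_cubes zz'; rewrite -subset0 -zz'; apply: setISS;
  by apply: (subset_trans (piece_cube (z := _))); apply: cubeS => i;
    rewrite ler_peMl ?ler1n// ltW.
exists P, (V / Q), rho0; split => //.
- by rewrite divr_gt0.
- rewrite bigmin_le_id andbT; apply: lt_bigmin => // i _.
  by rewrite divr_gt0.
- move=> y [z /sP[/ballP xz _] /piece_cube zy].
  have /ballP zy8 : ball z (r / 8) y by rewrite ball_cube//; exact: cubeS zy.
  by apply/ballP; have := metric_triangle x z y; lra.
split.
- move=> y [z zs zy] y' /ballP yy'; have [_ [La Rz]] := sP _ zs.
  exists (al z) => // i; have [_ [w Rw /ballP wy]] := zy i.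
  exists w => //; apply/ballP.
  have : mdist (y i) (y' i) < v i / 2.
    apply: le_lt_trans (lt_le_trans yy' _); last exact: bigmin_le.
    exact: maxdist_ge.
  by have := metric_triangle w (y i) (y' i); move=> /=; lra.
(* Lower bound: each piece has mass at least [b], by scaling with the halved width. *)
- pose b := \prod_i (K^-1 * ((v i / 2) `^ (delta i * (1 - kappa i)) * q i `^ (delta i * kappa i))).
  have sbP : (((size s)%:R * b)%:E <= mX P)%E.
    apply: (@measure_seq_ge _ _ _ mX _ (piece al) s P _ (apart q)) => //.
    - exact: mop.
    - by move=> z _; apply: mop; exact: piece_open.
    - by move=> z zs y zy; exists z.
    - move=> z zs; apply: (measure_box_ge mXE) => i.
      + by apply: openI; [exact: ball_openT|exact: nbhd_open].
      + by rewrite mulr_ge0 ?invr_ge0 ?(ltW K_gt0)// mulr_ge0 ?powR_ge0.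
      + have [_ [_ Rz]] := sP _ zs.
        have v20 : 0 < v i / 2 by rewrite divr_gt0.
        have v2q : v i / 2 <= q i by have /= := v_le i; have /= := v_gt0 i; lra.
        have /andP[_ q1] := q_lt i.
        by have [] := nbhd_reg v20 v2q q1 (Rz i).
  have bV : K^-1 ^+ d * (2 `^ D)^-1 * V <= b.
    rewrite /b prod_const -mulrA ler_wpM2l ?exprn_ge0 ?invr_ge0 ?(ltW K_gt0)//.
    rewrite ler_pdivrMl ?powR_gt0// powR_sum// -big_split/=.
    apply: ler_prod => i _; rewrite mulr_ge0 ?powR_ge0//= mulrA ler_wpM2r ?powR_ge0//.
    have de0 := delta_gt0 i; have ka0 := kappa_ge0 i; have ka1 := kappa_lt1 i.
    have e0 : 0 <= delta i * (1 - kappa i) by apply: mulr_ge0; rewrite ?subr_ge0 ltW.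
    apply: (@le_trans _ _ ((2 * (v i / 2)) `^ (delta i * (1 - kappa i)))).
      by rewrite (mulrC 2) divfK.
    rewrite powRM ?divr_ge0 ?(ltW (v_gt0 i))//.
    by rewrite ler_wpM2r ?powR_ge0// ler_powR ?ler1n//; nra.
  apply: le_trans sbP; rewrite lee_fin.
  apply: (le_trans _ (ler_wpM2l _ bV)) => //; move: cs.
  (* The 2 comes from the halved width, the 4 from the ubiquity ball of radius [r / 4], the 5 from
     the covering cubes of [resonant_net]. *)
  have -> : 40 = 2 * (4 * 5) :> R by ring.
  rewrite !powRM ?invr_ge0 ?mulr_ge0 ?(ltW r0)// exprVn.
  rewrite -(powR_inv1 (_ : 0 <= 4))// -powRrM mulN1r powRN.
  set k := K ^+ d; set p2 := 2 `^ D; set p4 := 4 `^ D; set p5 := 5 `^ D => cs'.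
  have p20 : 0 < p2 by rewrite powR_gt0.
  have p40 : 0 < p4 by rewrite powR_gt0.
  have p50 : 0 < p5 by rewrite powR_gt0.
  have -> : c * k^-1 ^+ 2 / (p2 * (p4 * p5)) * r `^ D * (V / Q) =
      (c * (r `^ D / p4)) * (k^-1 ^+ 2 / p2 / p5 * V / Q).
    by field; rewrite ?gt_eqF.
  apply: (le_trans (ler_wpM2r _ cs')).
    by rewrite !mulr_ge0 ?invr_ge0 ?exprn_ge0 ?invr_ge0// ltW.
  by rewrite le_eqVlt; apply/orP; left; apply/eqP; field; rewrite ?gt_eqF.
- move=> y h h0 h1.
  have h31 : 3 * h < r1 by lra.
  (* Frostman bound: only the pieces that meet the ball count. *)
  pose s' := [seq z <- s | `[< piece al z `&` ball y h !=set0 >]].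
  pose bb := \prod_i (K * 3 `^ delta i * (Num.min (v i) h `^ (delta i * (1 - kappa i))
      * Num.min (q i) h `^ (delta i * kappa i))).
  have le_bb : (mX (P `&` ball y h) <= ((size s')%:R * bb)%:E)%E.
    apply: (@measure_seq_le _ _ _ mX _ (fun z => piece al z `&` ball y h)) => //.
    - by apply: mop; apply: openI => //; exact: ball_openT.
    - by move=> z _; apply: mop; apply: openI; [exact: piece_open|exact: ball_openT].
    - move=> p [[z zs zp] yp]; exists z => //.
      by rewrite mem_filter zs andbT; apply/asboolP; exists p.
    - move=> z; rewrite mem_filter => /andP[_ /sP[_ [_ Rz]]].
      rewrite ball_cube//.
      have -> : piece al z `&` cube y (fun=> h) = box (fun i =>
          ball (z i) (q i) `&` nbhd (Res i (al z)) (v i / 2) `&` ball (y i) h).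
        apply/seteqP; split=> [p [zp yp] i|p zp].
          by split; [exact: zp|exact: yp].
        by split=> i; have [] := zp i.
      apply: (measure_box_le mXE) => i.
        by apply: openI; [apply: openI; [exact: ball_openT|exact: nbhd_open]|exact: ball_openT].
      have /andP[_ q1] := q_lt i.
      exact: (resonant_local_le _ (v_gt0 i) (v_le i) q1 h0 h31 (Rz i)).
  (* If a piece meets the ball, its whole cube lies within [h + q + q] of [y]; packing these cubes
     bounds their number. *)
  pose qh i := 3 * Num.max (q i) h.
  have qh0 i : 0 < Num.max (q i) h by rewrite lt_max h0 orbT.
  have qh1 i : 0 < qh i < r1.
    have /= := q_small i; rewrite /qh; case: (leP (q i) h) => *; apply/andP; split;
    have /= := q_gt0 i; lra.
  have ns' : (size s')%:R * (K^-1 ^+ d * Q) <= K ^+ d * \prod_i qh i `^ delta i.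
    apply: (packing_cubes mXE K_ge1 ball_reg q_lt (s := s') (V := cube y qh)).
    - exact: measurable_cube.
    - exact: (cube_le mXE ball_reg).
    - move=> z; rewrite mem_filter => /andP[/asboolP[p [/piece_cube zp yp]] _].
      move: yp; rewrite ball_cube// => yp p' zp' i; apply/ballP.
      have /ballP := zp i; have /ballP := yp i; have /ballP := zp' i.
      have := metric_triangle (y i) (p i) (p' i).
      have := metric_triangle (p i) (z i) (p' i); rewrite (mdistC (p i) (z i)) /qh.
      by case: (leP (q i) h) => ? ? ? ? ? ?; lra.
    - exact: subseq_pairwise (filter_subseq _ _) sq.
  apply: (le_trans le_bb); rewrite lee_fin.
  have rect : \prod_i (Num.max (q i) h `^ delta i) *
      (\prod_i (Num.min (v i) h `^ (delta i * (1 - kappa i))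
      * Num.min (q i) h `^ (delta i * kappa i))) <= h `^ T * V.
    rewrite -big_split/=; apply: rect_dim_scale => //; rewrite ?rho_gt0 ?h0//=.
    by have := r1_le1; lra.
  (* One factor 3 comes from [resonant_local_le], the other from [qh]. *)
  have -> : 9 = 3 * 3 :> R by ring.
  have -> : bb = K ^+ d * 3 `^ D * \prod_i (Num.min (v i) h `^ (delta i * (1 - kappa i))
      * Num.min (q i) h `^ (delta i * kappa i)).
    by rewrite /bb powR_sum// -prod_const -big_split.
  move: ns' rect; rewrite powRM// /qh prod_powRM//; last by move=> i; exact: ltW.
  rewrite exprVn.
  set k := K ^+ d; set p3 := 3 `^ D; set Mx := \prod_i _; set Mn := \prod_i _.
  move=> ns' rect.
  have p30 : 0 < p3 by rewrite powR_gt0.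
  have hT0 : 0 < h `^ T by rewrite powR_gt0.
  have Mn0 : 0 <= Mn by apply: prodr_ge0 => i _; rewrite mulr_ge0 ?powR_ge0.
  have -> : (size s')%:R * (k * p3 * Mn) =
      (size s')%:R * (k^-1 * Q) * (k ^+ 2 * p3 * Mn / Q).
    by field; rewrite ?gt_eqF.
  apply: (le_trans (ler_wpM2r _ ns')).
    by rewrite !mulr_ge0 ?invr_ge0 ?exprn_ge0// ltW.
  have -> : k * (p3 * Mx) * (k ^+ 2 * p3 * Mn / Q) = k ^+ 3 * (p3 * p3) / Q * (Mx * Mn).
    by ring.
  have -> : k ^+ 3 * (p3 * p3) * (V / Q) * h `^ T = k ^+ 3 * (p3 * p3) / Q * (h `^ T * V).
    by ring.
  by rewrite ler_wpM2l// !mulr_ge0 ?invr_ge0 ?exprn_ge0// ltW.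
Qed.

End construction.

End layer.

(** * Comparison of sums, infinite index sets, compactness *)

Section esum_scale.
Context {R : realType} {T : choiceType}.

Lemma esum_scale_le (A : set T) (f g : T -> R) (c B : R) :
  0 <= c -> (forall k, 0 <= f k) -> (forall k, 0 <= g k) ->
  (forall k, A k -> g k <= c * f k) ->
  (\esum_(k in A) (f k)%:E <= B%:E)%E -> (\esum_(k in A) (g k)%:E <= (c * B)%:E)%E.
Proof.
move=> c0 f0 g0 gf fB.
apply: (@le_trans _ _ (\esum_(k in A) (c * f k)%:E)%E).
  by apply: le_esum => k Ak; rewrite lee_fin gf.
apply: ge_ereal_sup => _ [F [finF FA] <-].
under eq_fsbigr do rewrite EFinM.
rewrite -ge0_mule_fsumr => [|k]; last by rewrite lee_fin.
rewrite EFinM lee_wpmul2l ?lee_fin//; apply: le_trans fB.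
by apply: ereal_sup_ubound; exists F.
Qed.

Lemma finite_lbound (A : set T) (f : T -> R) : finite_set A ->
  (forall k, A k -> 0 < f k) -> exists2 e : R, 0 < e & forall k, A k -> e <= f k.
Proof.
move=> /finite_seqP[s ->]; elim: s => [|k s IH] f0; first by exists 1.
have [|e e0 es] := IH; first by move=> j js; apply: f0; rewrite /= inE js orbT.
exists (Num.min e (f k)); first by rewrite lt_min e0 f0//= mem_head.
move=> j /=; rewrite inE => /orP[/eqP->|js]; first by rewrite ge_min lexx orbT.
by rewrite ge_min es.
Qed.

End esum_scale.

Lemma infinite_setN (A : set nat) :
  (forall N, exists2 n, (N <= n)%N & A n) -> infinite_set A.
Proof.
move=> AN /finite_seqP[s As].
have [n sn] := AN (\max_(k <- s) k).+1; rewrite As /= => ns.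
by move: sn; rewrite ltnNge => /negP; apply; exact: (@leq_bigmax_seq _ s xpredT id n ns isT).
Qed.

Section compact_metric.
Context {R : realType} {T : pmetricType R} (compactT : compact [set: T]).

Lemma compact_cluster_seq (u : nat -> T) :
  exists p : T, forall (e : R) (N : nat), 0 < e ->
    exists2 k, (N <= k)%N & mdist p (u k) < e.
Proof.
have [p [_ clp]] := @compactT (u k @[k --> \oo]) _ filterT.
exists p => e N e0.
have uN : (u k @[k --> \oo]) [set u k | k in [set k | (N <= k)%N]].
  by exists N => // k /= Nk; exists k.
have [_ [[k Nk <-] /ballP pk]] := clp _ _ uN (nbhsx_ballx p e e0).
by exists k.
Qed.

(** Otherwise there are points at distance more than [n] from [point] for every [n], and this
    sequence could not cluster. *)
Lemma compact_mdist_bounded : exists2 B : R, 0 < B & forall p q : T, mdist p q <= B.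
Proof.
apply: contrapT => nB.
have /choice[u uP] : forall n : nat, exists u : T, n%:R < mdist point u.
  (* Using [n.+1] keeps the bound positive when [n = 0]. *)
  move=> n; apply: contrapT => nu; apply: nB; exists (2 * n.+1%:R) => //.
  have nle (p : T) : mdist point p <= n.+1%:R.
    rewrite leNgt; apply/negP => np; apply: nu; exists p.
    by rewrite (lt_trans _ np)// ltr_nat.
  move=> p q; rewrite (le_trans (metric_triangle _ point _))// (mdistC p).
  by rewrite mulr2n mulrDl mul1r lerD.
have [p clp] := compact_cluster_seq u.
pose N := (Num.truncn (mdist point p + 1)).+1.
have [k Nk pk] := clp 1 N ltr01.
have := metric_triangle point p (u k); have := uP k.
have : mdist point p + 1 < N%:R := truncnS_gt _.
have : N%:R <= k%:R :> R by rewrite ler_nat.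
by lra.
Qed.

End compact_metric.

(** * Nested sparse balls and the content of the limsup set *)

Section nested_balls.
Context {R : realType} {d : nat} (d_gt0 : (0 < d)%N) (X : 'I_d -> pmetricType R).
Context (compactX : forall i, compact [set: X i])
  (m : forall i, {measure set (borelType (X i)) -> \bar R})
  (mX : {measure set (borelType (maxprod X)) -> \bar R})
  (mXE : is_product_measure m mX)
  (delta : 'I_d -> R) (delta_gt0 : forall i, 0 < delta i)
  (K r1 : R) (K_ge1 : 1 <= K) (r1_gt0 : 0 < r1) (r1_le1 : r1 <= 1)
  (ball_reg : forall i (x : X i) h, 0 < h -> h < r1 ->
    comparable_up_to K (h `^ delta i) (m i (ball x h))).
Implicit Types (x z : maxprod X).

Local Notation D := (\sum_i delta i).

Let K_gt0 : 0 < K. Proof. exact: lt_le_trans K_ge1. Qed.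

Let Kd_gt0 : 0 < K ^+ d. Proof. by rewrite exprn_gt0. Qed.

Lemma sum_delta_gt0 : 0 < D.
Proof.
rewrite (bigD1 (Ordinal d_gt0))//= ltr_pwDl// sumr_ge0// => i _.
by rewrite ltW.
Qed.

(** A ball of diameter 0 would lie in every ball around [x], and the masses of these tend to 0,
    against the lower regularity bound. *)
Lemma diam_ball_gt0 x (h : R) : 0 < h -> 0 < diam (ball x h).
Proof.
move=> h0; rewrite lt_neqAle diam_ball_ge0// andbT; apply/negP => /eqP/esym diam0.
have r10 := r1_gt0; have r11 := r1_le1; have D0 := sum_delta_gt0.
pose h' := Num.min h (r1 / 2).
have h'0 : 0 < h' by rewrite lt_min h0/=; lra.
have h'1 : h' < r1 by rewrite /h' gt_min; apply/orP; right; lra.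
pose k := K ^+ d.
(* With [e ^ D = z], the upper bound [k * e ^ D] is half of the lower bound for the mass of
   [ball x h']. *)
pose z := (k^-1 ^+ 2 / 2 * h' `^ D).
have k1 : 1 <= k by rewrite exprn_ege1.
have z0 : 0 < z by rewrite !mulr_gt0 ?exprn_gt0 ?invr_gt0 ?powR_gt0.
pose e := z `^ D^-1.
have eD : e `^ D = z by rewrite -powRrM mulVf ?gt_eqF// powRr1// ltW.
have e0 : 0 < e by rewrite powR_gt0.
have k01 : k^-1 <= 1 by rewrite invf_le1.
have e1 : e < r1.
  apply: le_lt_trans h'1; rewrite leNgt; apply/negP => h'e.
  have : h' `^ D < e `^ D by apply: powR_lt => //; exact: ltW.
  rewrite eD ltNge; apply/negP; rewrite negbK ler_piMl ?powR_ge0//.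
  by rewrite ler_pdivrMr// mul1r (le_trans (_ : _ <= 1)) ?ler1n// exprn_ile1// invr_ge0 ltW.
have : (mX (ball x h') <= mX (ball x e))%E.
  apply: le_measure; rewrite ?inE; [exact: measurable_ball_maxprod..|].
  move=> p /ballP xp; apply/ballP; apply: le_lt_trans e0; rewrite -diam0.
  apply: (@mdist_le_diam _ _ x h); apply/ballP; rewrite ?mdistxx//.
  by rewrite (lt_le_trans xp)// ge_min lexx.
rewrite leNgt; apply/negP; rewrite negbK.
apply: (@le_lt_trans _ _ (k * e `^ D)%:E).
  by apply: (ball_le mXE ball_reg); rewrite e0.
apply: (@lt_le_trans _ _ (K^-1 ^+ d * h' `^ D)%:E); last first.
  by apply: (ball_ge mXE K_ge1 ball_reg); rewrite h'0.
rewrite lte_fin eD /z (exprVn K d) -/k.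
have -> : k * (k^-1 ^+ 2 / 2 * h' `^ D) = k^-1 * h' `^ D / 2.
  by field; rewrite gt_eqF// (lt_le_trans _ k1).
have : 0 < k^-1 * h' `^ D by rewrite mulr_gt0 ?powR_gt0// invr_gt0.
by move=> ?; lra.
Qed.

Context (T : R) (T_ge0 : 0 <= T) (T_le : T <= D).

(** The value for which, in [sparse_ball], the doubled large members of the cover take at most half
    of the mass of [ball x (r / 2)]; [4 ^ D] accounts for the halved radius and the doubled
    diameters. *)
Definition content_const : R := (K ^+ d)^-1 ^+ 2 * (4 `^ D)^-1 / 2.

Lemma content_const_gt0 : 0 < content_const.
Proof. by rewrite !mulr_gt0 ?exprn_gt0 ?invr_gt0 ?powR_gt0// exprn_gt0. Qed.

Lemma content_const_le1 : content_const <= 1.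
Proof.
have k1 : 1 <= K ^+ d by rewrite exprn_ege1.
have p1 : 1 <= 4 `^ D.
  by rewrite -[leLHS](powRr0 4) ler_powR ?ler1n// ltW// sum_delta_gt0.
have k2 : (K ^+ d)^-1 ^+ 2 <= 1.
  by rewrite exprn_ile1 ?invr_ge0 ?(ltW Kd_gt0)// invf_le1.
have p2 : (4 `^ D)^-1 <= 1 :> R by rewrite invf_le1 ?powR_gt0.
rewrite /content_const ler_pdivrMr// mul1r (le_trans (_ : _ <= 1)) ?ler1n//.
by rewrite mulr_ile1// ?invr_ge0 ?powR_ge0// exprn_ge0// invr_ge0 ltW.
Qed.

Local Notation c0 := content_const.

Context (I : set nat) (y : nat -> maxprod X) (h : nat -> R)
  (h_gt0 : forall k, I k -> 0 < h k).

Local Notation U := (covering y h).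
Local Notation wt := (weight y h T).

Lemma diam_lt_of_weight (B : set nat) (r : R) k : 0 <= r ->
  (\esum_(j in B) wt j < (r `^ T)%:E)%E -> B k -> diam (U k) < r.
Proof.
move=> r0 Br Bk; rewrite ltNge; apply/negP => rk.
have := le_lt_trans (esum_term_le (weight_ge0 y h T) Bk) Br.
by rewrite lte_fin ltNge powR_le.
Qed.

Lemma meeting_meeting z (e : R) x (r : R) : ball z e `<=` ball x r ->
  meeting (meeting I y h x r) y h z e = meeting I y h z e.
Proof.
move=> zx; apply/seteqP; split => k [].
  by case.
move=> Ik [p [Up zp]]; split; last by exists p.
by split => //; exists p; split => //; exact: zx.
Qed.

(** This is [pigeonhole] for [mX] on [ball x (r / 2)], with exponent [D]. Finitely many members of
    the cover carry all but [S] of the sum, and [e] is taken below their diameters, which are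
    positive. *)
Lemma sparse_ball x (r eta : R) : 0 < r -> r <= r1 / 8 -> 0 < eta ->
  (\esum_(k in meeting I y h x r) wt k < (c0 * r `^ T)%:E)%E ->
  exists z (e : R), [/\ ball x (r / 2) z, 0 < e <= r / 16 &
    (\esum_(k in meeting I y h z e) wt k <= (eta * e `^ D)%:E)%E].
Proof.
move=> r0 rr1 eta0 inv.
have r10 := r1_gt0; have r11 := r1_le1; have D0 := sum_delta_gt0.
set I' := meeting I y h x r in inv *.
have hI' k : I' k -> 0 < h k by case=> /h_gt0.
have rT0 : 0 < r `^ T by rewrite powR_gt0.
have inv' : (\esum_(k in I') wt k < (r `^ T)%:E)%E.
  by rewrite (lt_le_trans inv)// lee_fin ler_piMl ?content_const_le1// ltW.
pose k0 := K ^+ d.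
pose M := k0^-1 * (r / 2) `^ D.
have M0 : 0 < M by rewrite mulr_gt0 ?invr_gt0 ?powR_gt0// divr_gt0.
(* Solves [S * (4 * k0 * (4 * e) ^ D / M) = eta * e ^ D], whatever [e] is. *)
pose S := eta * M / (4 * k0 * 4 `^ D).
have S0 : 0 < S.
  apply: divr_gt0; first exact: mulr_gt0.
  by apply: mulr_gt0; [exact: mulr_gt0|exact: powR_gt0].
have [F [finF FI'] FS] := esum_tail_small (weight_ge0 y h T) S0 (lt_trans inv' (ltry _)).
have [e1 e10 e1F] := finite_lbound (f := fun k => diam (U k)) finF
  (fun k Fk => diam_ball_gt0 (y k) (hI' k (FI' k Fk))).
pose e := Num.min (r / 16) (e1 / 2).
have e0 : 0 < e by rewrite lt_min !divr_gt0.
have er : e <= r / 16 by rewrite ge_min lexx.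
have [z xz zS] : exists2 z, ball x (r / 2) z &
    (\esum_(k in meeting I' y h z e) wt k <= (S * (4 * k0 * (4 * e) `^ D / M))%:E)%E.
  apply: (pigeonhole mXE K_ge1 ball_reg hI' (V := ball x r) (v := k0 * r `^ D)).
- exact: measurable_ball_maxprod.
- exact: measurable_ball_maxprod.
- by apply: (ball_le mXE ball_reg); rewrite r0/=; lra.
- by [].
- lra.
- move=> z /ballP xz p /ballP zp; apply/ballP.
  by have := metric_triangle x z p; lra.
- by [].
- by [].
- by [].
- move=> z e' e'0 e'1; apply: (@le_trans _ _ (mX (ball z e'))).
    apply: le_measure; rewrite ?inE; last by move=> ? [].
      by apply: measurableI; exact: measurable_ball_maxprod.
    exact: measurable_ball_maxprod.
  by apply: (ball_le mXE ball_reg); rewrite e'0/=; lra.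
- move=> k I'k _; have := diam_lt_of_weight (ltW r0) inv' I'k; lra.
- by rewrite /M -exprVn; apply: (ball_ge mXE K_ge1 ball_reg); rewrite divr_gt0//=; lra.
(* All diameters are below [r], so [diam ^ D <= r ^ (D - T) * diam ^ T] and the assumed bound on the
   weights applies. *)
- have -> : M / 2 = (k0 * 2 `^ D * r `^ (D - T)) * (c0 * r `^ T).
    rewrite /M /c0 -/k0 powRM ?invr_ge0 ?(ltW r0)//.
    have -> : 4 = 2 * 2 :> R by ring.
    rewrite powRM// -(powR_inv1 (_ : 0 <= 2))// -powRrM mulN1r powRN.
    have -> : r `^ D = r `^ (D - T) * r `^ T by rewrite -powRDp// subrK.
    have p20 : 0 < 2 `^ D :> R by rewrite powR_gt0.
    by field; rewrite ?gt_eqF.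
  apply: (esum_scale_le (f := fun k => diam (U k) `^ T)).
  - by rewrite !mulr_ge0 ?powR_ge0// ltW.
  - by move=> k; exact: powR_ge0.
  - by move=> k; rewrite mulr_ge0 ?powR_ge0// ltW.
  - move=> k [I'k _]; have dr := diam_lt_of_weight (ltW r0) inv' I'k.
    have dk : 0 < diam (U k) by apply: diam_ball_gt0; exact: hI'.
    rewrite powRM ?(ltW dk)// -!mulrA ler_pM2l// ler_pM2l ?powR_gt0//.
    rewrite -{1}(subrK T D) powRDp// ler_wpM2r ?powR_ge0//.
    by apply: powR_le; rewrite ?subr_ge0// ltW.
  - apply: le_trans (ltW inv); apply: subset_esum; first exact: weight_ge0.
    by move=> k [].
- apply: le_trans FS; apply: subset_esum; first exact: weight_ge0.
  move=> k [I'k ke]; split => // /e1F ek.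
  have : e <= e1 / 2 by rewrite ge_min lexx orbT.
  by move: ke => /=; lra.
exists z, e; split => //; first by rewrite e0.
move: zS; rewrite meeting_meeting; last first.
  move=> p /ballP zp; move/ballP: xz => xz; apply/ballP.
  by have := metric_triangle x z p; lra.
move=> /le_trans; apply; rewrite lee_fin powRM ?(ltW e0)// /S.
have p40 : 0 < 4 `^ D :> R by rewrite powR_gt0.
by rewrite le_eqVlt; apply/orP; left; apply/eqP; field; rewrite ?gt_eqF.
Qed.

Context (E : nat -> set (maxprod X)) (cm cf : R) (c5_gt0 : 0 < cm) (C5_gt0 : 0 < cf).

(* A measure of total mass [cm r^D], carried by [E n] within a ball of radius
   [r], with Frostman exponent [T]: the restriction of [mX] to [P], over [w]. *)
Context (layers : forall x (r : R) (N : nat), 0 < r -> r <= r1 / 8 ->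
  exists (n : nat) (P : set (maxprod X)) (w rho0 : R),
  [/\ (N <= n)%N, 0 < w, 0 < rho0 <= r / 16, open P & P `<=` ball x (3 * r / 4)] /\
  [/\ forall z, P z -> ball z rho0 `<=` E n,
      ((cm * r `^ D * w)%:E <= mX P)%E &
      forall z e, 0 < e -> e <= r1 / 4 ->
        (mX (P `&` ball z e) <= (cf * w * e `^ T)%:E)%E]).

(** This is [pigeonhole] for the measure of a layer, with exponent [T]. In the minimum, [2^-1]
    forces the diameters below [e]; the other term bounds the mass removed and gives the final
    constant [c0]. *)
Lemma sparse_ball_layer z (e : R) (N : nat) : 0 < e -> e <= r1 / 8 ->
  (\esum_(k in meeting I y h z e) wt k <=
    (Num.min (2^-1) (c0 * cm / (8 * cf * 4 `^ D)) * e `^ D)%:E)%E ->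
  exists (n : nat) z' (e' : R), [/\ (N <= n)%N, ball z (3 * e / 4) z',
    0 < e' <= e / 16, ball z' e' `<=` E n &
    (\esum_(k in meeting I y h z' e') wt k < (c0 * e' `^ T)%:E)%E].
Proof.
move=> e0 er1; set eta := Num.min _ _ => sparse.
have r10 := r1_gt0; have r11 := r1_le1; have D0 := sum_delta_gt0.
have c00 := content_const_gt0; have c01 := content_const_le1.
have p40 : 0 < 4 `^ D :> R by rewrite powR_gt0.
have den0 : 0 < 8 * cf * 4 `^ D by apply: mulr_gt0 => //; exact: mulr_gt0.
have eta0 : 0 < eta.
  rewrite lt_min; apply/andP; split; first by rewrite invr_gt0.
  by apply: divr_gt0 => //; exact: mulr_gt0.
have eta1 : eta <= 2^-1 by rewrite ge_min lexx.
have eta2 : eta * (8 * cf * 4 `^ D) <= c0 * cm.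
  by rewrite -ler_pdivlMr// ge_min lexx orbT.
have [n [P [w [rho0 [[Nn w0 /andP[rho00 rho01] oP PV] [PE MP frost]]]]]] :=
  layers z N e0 er1.
set I' := meeting I y h z e in sparse *.
have hI' k : I' k -> 0 < h k by case=> /h_gt0.
have eD0 : 0 < e `^ D by rewrite powR_gt0.
(* As [e <= 1] and [T <= D], a bound by [e ^ D / 2] is also one by [e ^ T / 2]. *)
have inv' : (\esum_(k in I') wt k < (e `^ T)%:E)%E.
  apply: (le_lt_trans sparse); rewrite lte_fin.
  have : e `^ D <= e `^ T by apply: ger_powR => //; rewrite e0/=; lra.
  by have : 0 < e `^ T; [rewrite powR_gt0|nra].
have [z' Pz' small] : exists2 z', P z' &
    (\esum_(k in meeting I' y h z' rho0) wt k <= (eta * e `^ D *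
      (4 * (cf * w) * (4 * rho0) `^ T / (cm * e `^ D * w)))%:E)%E.
  apply: (pigeonhole mXE K_ge1 ball_reg hI' (V := ball z e) (v := K ^+ d * e `^ D)) => //.
- exact: open_measurable_borel.
- exact: measurable_ball_maxprod.
- by apply: (ball_le mXE ball_reg); rewrite e0/=; lra.
- lra.
- move=> p /PV/ballP zp p' /ballP pp'; apply/ballP.
  by have := metric_triangle z p p'; lra.
- by rewrite mulr_gt0.
- by rewrite !mulr_gt0.
- by rewrite mulr_gt0.
- move=> k I'k _; have := diam_lt_of_weight (ltW e0) inv' I'k; lra.
(* Doubling a diameter costs [2 ^ T <= 4 ^ D]; then [eta2] and [c0 <= 1] leave at most half of the
   mass. *)
- apply: (@le_trans _ _ (cf * w * 4 `^ D * (eta * e `^ D))%:E); last first.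
    rewrite lee_fin; have -> : cm * e `^ D * w / 2 = e `^ D * w * (cm / 2) by ring.
    have -> : cf * w * 4 `^ D * (eta * e `^ D) = e `^ D * w * (eta * (8 * cf * 4 `^ D) / 8).
      by field.
    rewrite ler_pM2l ?mulr_gt0//; have cm' := c5_gt0; nra.
  apply: (esum_scale_le (f := fun k => diam (U k) `^ T)).
  - by rewrite !mulr_ge0 ?powR_ge0// ltW.
  - by move=> k; exact: powR_ge0.
  - by move=> k; rewrite !mulr_ge0 ?powR_ge0// ltW.
  - move=> k [I'k _]; have dk := diam_ball_ge0 (y k) (hI' _ I'k).
    rewrite powRM// mulrA ler_wpM2r ?powR_ge0// ler_pM2l ?mulr_gt0//.
    apply: (@le_trans _ _ (2 `^ D)); first by rewrite ler_powR ?ler1n.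
    by apply: powR_le; rewrite ?(ltW D0)// ler_nat.
  - apply: le_trans sparse; apply: subset_esum; first exact: weight_ge0.
    by move=> k [].
- apply: le_trans sparse; apply: subset_esum; first exact: weight_ge0.
  by move=> k [].
exists n, z', rho0; split => //.
- exact: PV.
- by rewrite rho00.
- exact: PE.
move: small; rewrite meeting_meeting; last first.
  move=> p /ballP z'p; move/PV/ballP: Pz' => zz'; apply/ballP.
  by have := metric_triangle z z' p; lra.
move=> /le_lt_trans; apply; rewrite lte_fin.
have -> : eta * e `^ D * (4 * (cf * w) * (4 * rho0) `^ T / (cm * e `^ D * w)) =
    eta * (4 * cf * (4 * rho0) `^ T / cm).
  by field; rewrite ?gt_eqF.
rewrite powRM ?(ltW rho00)//.
have -> : eta * (4 * cf * (4 `^ T * rho0 `^ T) / cm) =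
    eta * (4 * cf * 4 `^ T) / cm * rho0 `^ T by ring.
rewrite ltr_pM2r ?powR_gt0// ltr_pdivrMr//.
have p4T : 4 `^ T <= 4 `^ D :> R by rewrite ler_powR ?ler1n.
have : eta * (4 * cf * 4 `^ T) <= eta * (4 * cf * 4 `^ D).
  by rewrite ler_pM2l// ler_pM2l// mulr_gt0.
have : 0 < c0 * cm by rewrite mulr_gt0.
have E8 : eta * (8 * cf * 4 `^ D) = 2 * (eta * (4 * cf * 4 `^ D)) by ring.
by move: eta2; rewrite E8; lra.
Qed.


(** The first ball improves the bound from [c0 * r ^ T] to a small multiple of [e ^ D]; the second
    spends this gain to enter some [E n] and recovers the initial form of the bound. The margin
    [3 / 4] keeps limit points strictly inside. *)
Lemma nested_step x (r : R) (N : nat) : 0 < r -> r <= r1 / 8 ->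
  (\esum_(k in meeting I y h x r) wt k < (c0 * r `^ T)%:E)%E ->
  exists (n : nat) z (e : R), [/\ (N <= n)%N, mdist x z + e <= 3 / 4 * r,
    0 < e <= r / 2, ball z e `<=` E n &
    (\esum_(k in meeting I y h z e) wt k < (c0 * e `^ T)%:E)%E].
Proof.
move=> r0 rr1 inv; have cm' := c5_gt0; have cf' := C5_gt0.
have c00 := content_const_gt0.
set eta := Num.min (2^-1) (c0 * cm / (8 * cf * 4 `^ D)).
have eta0 : 0 < eta.
  rewrite lt_min; apply/andP; split; first by rewrite invr_gt0.
  apply: divr_gt0; first exact: mulr_gt0.
  by apply: mulr_gt0; [exact: mulr_gt0|exact: powR_gt0].
have [z [e [/ballP xz /andP[e0 er] sparse]]] := sparse_ball r0 rr1 eta0 inv.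
have er1 : e <= r1 / 8 by lra.
have [n [z' [e' [Nn /ballP zz' /andP[e'0 e'e] E' inv']]]] :=
  sparse_ball_layer N e0 er1 sparse.
exists n, z', e'; split => //; last by rewrite e'0/=; lra.
by have := metric_triangle x z z'; lra.
Qed.

(** Otherwise [nested_step] iterates, and the limit point lies in infinitely many [E n], hence in
    some [U k]. This [U k] meets every ball of the sequence, so its diameter is below all the radii,
    although it is positive. *)
Lemma limsup_content_ge x (r : R) : 0 < r -> r <= r1 / 8 ->
  [set z | infinite_set [set n | E n z]] `&` ball x r `<=` \bigcup_(k in I) U k ->
  ((c0 * r `^ T)%:E <= \esum_(k in I) wt k)%E.
Proof.
move=> r0 rr1 cover; rewrite leNgt; apply/negP => small.
pose inv (p : maxprod X * R) := [/\ 0 < p.2, p.2 <= r1 / 8 &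
  (\esum_(k in meeting I y h p.1 p.2) wt k < (c0 * p.2 `^ T)%:E)%E].
have inv0 : inv (x, r).
  split => //; apply: le_lt_trans small; apply: subset_esum; first exact: weight_ge0.
  by move=> k [].
pose st := {p | inv p}.
have /choice[f fP] : forall pN : st * nat, exists q : st,
    [/\ mdist (sval pN.1).1 (sval q).1 + (sval q).2 <= 3 / 4 * (sval pN.1).2,
        (sval q).2 <= (sval pN.1).2 / 2 &
        exists2 n, (pN.2 <= n)%N & ball (sval q).1 (sval q).2 `<=` E n].
  move=> [[[z e] zP] N]; have [e0 er ze] := zP.
  have [n [z' [e' [Nn zz' /andP[e'0 e'e] E' inv']]]] := nested_step N e0 er ze.
  have z'P : inv (z', e').
    by split => //=; apply: le_trans er => /=; move: e'e e0 => /=; lra.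
  by exists (exist _ (z', e') z'P); split => //=; exists n.
(* Step [N] asks for a level at least [N], so the levels are unbounded. *)
pose s := fix s (N : nat) : st :=
  if N is N'.+1 then f (s N', N') else exist _ (x, r) inv0.
pose c N := (sval (s N)).1; pose e N := (sval (s N)).2.
have sP N : [/\ mdist (c N) (c N.+1) + e N.+1 <= 3 / 4 * e N, e N.+1 <= e N / 2 &
    exists2 n, (N <= n)%N & ball (c N.+1) (e N.+1) `<=` E n].
  exact: (fP (s N, N)).
have e_gt0 N : 0 < e N by have [] := svalP (s N).
have nested N k : (N <= k)%N -> mdist (c N) (c k) + e k <= e N.
  elim: k => [|k IH]; first by rewrite leqn0 => /eqP->; rewrite mdistxx add0r.
  rewrite leq_eqVlt => /orP[/eqP->|]; first by rewrite mdistxx add0r.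
  rewrite ltnS => /IH Nk; have [ck _ _] := sP k; have ek := e_gt0 k.
  by have := metric_triangle (c N) (c k) (c k.+1); lra.
(* Cluster points are taken separately in each factor: the distance bounds hold coordinatewise and
   pass to the maximum. *)
have [p cp] : exists p : maxprod X, forall N, mdist (c N) p <= e N.
  have pP i : exists p : X i, forall N, mdist (c N i) p <= e N.
    have [p clp] := compact_cluster_seq (@compactX i) (fun k => c k i).
    exists p => N; apply/ler_addgt0Pr => eps eps0.
    have [k Nk pk] := clp eps N eps0.
    have cle : mdist (c N i) (c k i) <= mdist (c N) (c k) := maxdist_ge (c N) (c k) i.
    have := nested N k Nk; have := e_gt0 k.
    by have := metric_triangle (c N i) (c k i) p; rewrite (mdistC (c k i) p); lra.
  exists (fun i => projT1 (cid (pP i))) => N.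
  apply: bigmax_le => [|i _]; first exact: ltW.
  by have := projT2 (cid (pP i)) N.
have cp' N : ball (c N) (e N) p.
  apply/ballP; have [cc ee _] := sP N; have eN := e_gt0 N.
  by have := metric_triangle (c N) (c N.+1) p; have := cp N.+1; lra.
have [] := cover p.
  split; last exact: (cp' 0%N).
  apply: infinite_setN => N; have [_ _ [n Nn En]] := sP N.
  by exists n => //; apply: En; exact: cp'.
move=> k Ik Up.
have dk N : diam (U k) < e N.
  have [_ _ invN] := svalP (s N).
  apply: (diam_lt_of_weight (B := meeting I y h (c N) (e N)) (ltW (e_gt0 N))).
    by apply: (lt_le_trans invN); rewrite lee_fin ler_piMl ?content_const_le1 ?powR_ge0.
  by split => //; exists p.
(* Halving at each step gives more, but this decay suffices and avoids powers. *)
have e_le N : e N * N.+1%:R <= r.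
  elim: N => [|N IH]; first by rewrite mulr1.
  have [_ ee _] := sP N; have eN := e_gt0 N; have eN1 := e_gt0 N.+1.
  have N0 : 1 <= N.+1%:R :> R by rewrite ler1n.
  by rewrite -natr1; nra.
have d0 := diam_ball_gt0 (y k) (h_gt0 Ik).
(* For this index [diam (U k) * N.+1] exceeds [r], whereas [e_le] and [dk] bound it by [r]. *)
pose N := Num.truncn (r / diam (U k)).
have := truncnS_gt (r / diam (U k)); rewrite -/N ltr_pdivrMr// ltNge => /negP; apply.
rewrite mulrC; apply: le_trans (e_le N); rewrite ler_wpM2r//; exact: ltW.
Qed.

End nested_balls.

(** * Elementary bounds for the Hausdorff content *)

Section hausdorff_content.
Context {R : realType} {T : metricType R}.

Lemma hausdorff_content_subset (s : R) (A B : set T) : A `<=` B ->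
  (hausdorff_content s A <= hausdorff_content s B)%E.
Proof.
move=> AB; apply: ereal_inf_le_tmp => _ [I [x [r [r0 cover ->]]]].
by exists I, x, r; split => //; exact: subset_trans cover.
Qed.

Lemma hausdorff_content_ball_le (s : R) (x : T) (r : R) : 0 < r ->
  (hausdorff_content s (ball x r) <= (diam (ball x r) `^ s)%:E)%E.
Proof.
move=> r0; apply: ereal_inf_lbound; exists [set 0%N], (fun=> x), (fun=> r).
split => //; first by move=> y xy; exists 0%N.
by rewrite esum_set1// lee_fin powR_ge0.
Qed.

End hausdorff_content.

(** * Constants common to all directions *)

Section regularity_constants.
Context {R : realType}.

Lemma comparable_up_to_weaken (C K u : R) (v : \bar R) : 0 < C -> C <= K -> 0 <= u ->
  comparable_up_to C u v -> comparable_up_to K u v.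
Proof.
move=> C0 CK u0 [lev vle]; have K0 : 0 < K by exact: lt_le_trans CK.
split; first by rewrite (le_trans _ lev)// lee_fin ler_wpM2r// lef_pV2.
by rewrite (le_trans vle)// lee_fin ler_wpM2r.
Qed.

Lemma uniform_constants (d : nat) (X : 'I_d -> pmetricType R)
    (m : forall i, {measure set (borelType (X i)) -> \bar R})
    (delta kappa : 'I_d -> R) (J : Type) (Res : forall i, J -> set (X i)) :
  (forall i, ahlfors_regular (m i) (delta i)) ->
  (forall i, kappa_scaling (m i) (delta i) (kappa i) (Res i)) ->
  exists K r1 : R, [/\ 1 <= K, 0 < r1, r1 <= 1,
    forall i (x : X i) h, 0 < h -> h < r1 ->
      comparable_up_to K (h `^ delta i) (m i (ball x h)) &
    forall i eta h alpha (x : X i), 0 < eta -> eta <= h -> h < r1 ->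
      Res i alpha x ->
      comparable_up_to K
        (eta `^ (delta i * (1 - kappa i)) * h `^ (delta i * kappa i))
        (m i (ball x h `&` nbhd (Res i alpha) eta))].
Proof.
move=> reg sca.
have /choice[C1 C1P] : forall i, exists C : R, 0 < C /\ forall (x : X i) r,
    0 < r -> r < diam [set: X i] -> comparable_up_to C (r `^ delta i) (m i (ball x r)).
  by move=> i; have [_ [C C0 CP]] := reg i; exists C.
have /choice[C2 C2P] : forall i, exists C : R, 0 < C /\ forall eta r alpha (x : X i),
    0 < eta -> eta <= r -> r < diam [set: X i] -> Res i alpha x ->
    comparable_up_to C (eta `^ (delta i * (1 - kappa i)) * r `^ (delta i * kappa i))
      (m i (ball x r `&` nbhd (Res i alpha) eta)).
  by move=> i; have [C C0 CP] := sca i; exists C.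
(* The sum dominates every constant and 1. The threshold [r1] is positive as a minimum of finitely
   many positive diameters and 1. *)
pose K := 1 + \sum_i C1 i + \sum_i C2 i.
pose r1 := \big[Num.min/1]_i diam [set: X i].
have C1K i : C1 i <= K.
  rewrite /K (bigD1 i)//= -[leLHS]addr0 addrCA -!addrA lerD2l !addr_ge0// sumr_ge0// => j _;
  by rewrite ltW//; case: (C1P j); case: (C2P j).
have C2K i : C2 i <= K.
  rewrite /K addrC [X in _ <= X + _](bigD1 i)//= -[leLHS]addr0 -!addrA lerD2l !addr_ge0// sumr_ge0// => j _;
  by rewrite ltW//; case: (C1P j); case: (C2P j).
exists K, r1; split.
- by rewrite /K -addrA lerDl addr_ge0// sumr_ge0// => j _;
  rewrite ltW//; case: (C1P j); case: (C2P j).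
- by apply: lt_bigmin => // i _; case: (reg i).
- exact: bigmin_le_id.
- move=> i x h h0 h1; have [C0 H] := C1P i.
  apply: (comparable_up_to_weaken C0 (C1K i)); first exact: powR_ge0.
  by apply: H => //; apply: lt_le_trans h1 _; exact: bigmin_le.
- move=> i eta h alpha x eta0 etah h1 Rx; have [C0 H] := C2P i.
  apply: (comparable_up_to_weaken C0 (C2K i)); first by rewrite mulr_ge0 ?powR_ge0.
  by apply: H Rx => //; apply: lt_le_trans h1 _; exact: bigmin_le.
Qed.

End regularity_constants.

(** * Limsup sets and upper limits *)

Section limsup.
Context {R : realType}.

Lemma infinite_setP (A : set nat) :
  infinite_set A <-> forall N, exists2 n, (N <= n)%N & A n.
Proof.
split=> [infA N|]; last exact: infinite_setN.
apply: contrapT => nN; apply: infA; apply: (sub_finite_set _ (finite_II N)) => n An /=.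
by rewrite ltnNge; apply/negP => Nn; apply: nN; exists n.
Qed.

(** The limsup set is the intersection over [N] of the open unions over [n >= N]. *)
Lemma Gdelta_limsup (T : topologicalType) (E : nat -> set T) :
  (forall n, open (E n)) -> Gdelta [set x | infinite_set [set n | E n x]].
Proof.
move=> oE; exists (fun N => \bigcup_(n in [set n | (N <= n)%N]) E n).
  by move=> N; apply: bigcup_open => n _.
apply/seteqP; split => [x /infinite_setP Ex N _|x Ex].
  by have [n Nn En] := Ex N; exists n.
by apply/infinite_setP => N; have [n Nn En] := Ex N Logic.I; exists n.
Qed.

(** If [f] stayed below [s] from some [N] on, so would the supremum of that tail, hence the upper
    limit would be at most [s]. *)
Lemma limn_sup_frequently (f : nat -> R) (B s : R) :
  (forall n, 0 <= f n <= B) -> s < limn_sup f ->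
  forall N, exists2 n, (N <= n)%N & s <= f n.
Proof.
move=> fB; rewrite limn_supE; last first.
  exists B; split; first exact: num_real.
  by move=> M BM n _ /=; have /andP[f0 fle] := fB n; rewrite ger0_norm// (le_trans fle)// ltW.
move=> sf N; apply: contrapT => nN; move: sf; rewrite ltNge => /negP; apply.
have ub n : has_ubound (sdrop f n).
  by exists B => _ [k _ <-]; have /andP[] := fB k.
apply: (@le_trans _ _ (sups f N)).
  apply: ge_inf; last by exists N.
  exists 0 => _ [n _ <-]; have /andP[f0 _] := fB n.
  by apply: (le_trans f0); apply: ub_le_sup => //; exists n => /=.
apply: ge_sup; first by exists (f N), N => /=.
move=> _ [k Nk <-]; rewrite leNgt; apply/negP => sk.
by apply: nN; exists k => //; exact: ltW.
Qed.

Lemma limn_einf_eventually (f : nat -> \bar R) (b : \bar R) : (b < limn_einf f)%E ->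
  exists N, forall n, (N <= n)%N -> (b <= f n)%E.
Proof.
rewrite limn_einf_lim (cvg_lim _ (@cvg_einfs_sup R f))// => /ereal_sup_gt[_ [N _ <-] bN].
exists N => n Nn; apply: (le_trans (ltW bN)).
by apply: ereal_inf_lbound; exists n.
Qed.

End limsup.

(** * Uniform content bounds and the large intersection classes *)

Lemma mdist_maxprod_bounded (R : realType) (d : nat) (X : 'I_d -> pmetricType R) :
  (forall i, compact [set: X i]) ->
  exists2 B : R, 0 < B & forall x y : maxprod X, mdist x y <= B.
Proof.
move=> cX.
have /choice[B BP] : forall i, exists B : R, 0 < B /\ forall p q : X i, mdist p q <= B.
  by move=> i; have [B B0 BP] := compact_mdist_bounded (cX i); exists B.
exists (\big[Num.max/1]_i B i); first by rewrite (lt_le_trans ltr01)// bigmax_ge_id.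
move=> x y; apply: bigmax_le => [|i _]; first by rewrite (le_trans ler01)// bigmax_ge_id.
by have [_ Bi] := BP i; rewrite (le_trans (Bi _ _))//; exact: (le_bigmax 1 B i).
Qed.

(** One constant [c] serves all exponents [T], as the class [large_inter1] demands. Small radii come
    from [limsup_content_ge]; a larger ball is compared with a concentric one of radius [r1 / 8],
    since the space is bounded. *)
Lemma limsup_rectangles_content (R : realType) (d : nat) (d_gt0 : (0 < d)%N)
  (X : 'I_d -> pmetricType R)
  (compactX : forall i, compact [set: X i])
  (m : forall i, {measure set (borelType (X i)) -> \bar R})
  (delta : 'I_d -> R) (delta_gt0 : forall i, 0 < delta i)
  (regm : forall i, ahlfors_regular (m i) (delta i))
  (mX : {measure set (borelType (maxprod X)) -> \bar R})
  (mXE : is_product_measure m mX)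
  (J : Type) (J_infinite : infinite_set [set: J])
  (beta : J -> R)
  (l u : nat -> R) (lt_lu : forall n, l n < u n)
  (l_cvg : l n @[n --> \oo] --> +oo)
  (rho : R -> R) (rho_gt0 : forall x, 0 < x -> 0 < rho x)
  (rho_cvg : rho x @[x --> +oo] --> (0 : R))
  (a : 'I_d -> R) (a_gt0 : forall i, 0 < a i)
  (t : nat -> 'I_d -> R) (t_gt0 : forall n i, 0 < t n i)
  (kappa : 'I_d -> R) (kappa_ge0 : forall i, 0 <= kappa i)
  (kappa_lt1 : forall i, kappa i < 1)
  (Res : forall i, J -> set (X i))
  (scalingR : forall i, kappa_scaling (m i) (delta i) (kappa i) (Res i))
  (ubiq : uniform_local_ubiquity mX beta l u Res rho a) :
  exists2 c : R, 0 < c & forall (T : R) (x : maxprod X) (r : R), 0 <= T ->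
    (forall N, exists2 n, (N <= n)%N & T <= rect_dim delta kappa a (t n)) -> 0 < r ->
    (c%:E * hausdorff_content T (ball x r)
      < hausdorff_content T (W beta l u Res rho a t `&` ball x r))%E.
Proof.
have [K [r1 [K1 r10 r11 bR nR]]] := uniform_constants regm scalingR.
have [cu cu0 cuP] := ubiq.
have [alpha0 _] := infinite_setN0 J_infinite.
have [B B0 BP] := mdist_maxprod_bounded compactX.
set D := \sum_i delta i.
have D0 : 0 < D := sum_delta_gt0 d_gt0 delta_gt0.
have k0 : 0 < K ^+ d by rewrite exprn_gt0// (lt_le_trans ltr01).
pose E n := \bigcup_(alpha in Jn beta l u n)
  rect_nbhd Res alpha (rho (u n)) (fun i => a i + t n i).
have u_cvg : u n @[n --> \oo] --> +oo.
  by apply: ger_cvgy l_cvg; apply: nearW => n; exact: ltW.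
have rhou_cvg : (rho \o u) n @[n --> \oo] --> (0 : R).
  exact: cvg_comp u_cvg rho_cvg.
have rho_small (r : R) : 0 < r -> exists N, forall n, (N <= n)%N ->
    [/\ 0 < rho (u n), rho (u n) < 1 & forall i, rho (u n) `^ a i <= r].
  (* Below this threshold [rho ^ a i <= r] holds in all directions at once. *)
  move=> r0; pose eps := \big[Num.min/1]_i (r `^ (a i)^-1).
  have eps0 : 0 < eps by apply: lt_bigmin => // i _; rewrite powR_gt0.
  have [Na _ NaP] := cvgr_lt 0 rhou_cvg eps eps0.
  have [Nb _ NbP] := cvgry_gt u_cvg 0.
  exists (maxn Na Nb) => n; rewrite geq_max => /andP[an bn].
  have run : 0 < rho (u n) by apply: rho_gt0; exact: NbP.
  have rule : rho (u n) < eps by exact: (NaP n an).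
  split=> // [|i]; first by apply: (lt_le_trans rule); exact: bigmin_le_id.
  have -> : r = (r `^ (a i)^-1) `^ a i.
    by rewrite -powRrM mulVf ?gt_eqF// powRr1// ltW.
  apply: powR_le; [exact: ltW|exact: ltW|].
  by apply: (le_trans (ltW rule)); exact: bigmin_le.
(* The ubiquity constant once the mass of a ball is replaced by a power of its radius. *)
pose c' := cu * K^-1 ^+ d.
have c'0 : 0 < c' by rewrite mulr_gt0// exprn_gt0// invr_gt0 (lt_le_trans ltr01).
have layers T : (forall N, exists2 n, (N <= n)%N & T <= rect_dim delta kappa a (t n)) ->
  forall (x : maxprod X) (r : R) (N : nat), 0 < r -> r <= r1 / 8 ->
  exists (n : nat) (P : set (maxprod X)) (w rho0 : R),
  [/\ (N <= n)%N, 0 < w, 0 < rho0 <= r / 16, open P & P `<=` ball x (3 * r / 4)] /\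
  [/\ forall z, P z -> ball z rho0 `<=` E n,
      ((c' * (K^-1 ^+ d) ^+ 2 * (40 `^ D)^-1 * r `^ D * w)%:E <= mX P)%E &
      forall z e, 0 < e -> e <= r1 / 4 ->
        (mX (P `&` ball z e) <= ((K ^+ d) ^+ 3 * 9 `^ D * w * e `^ T)%:E)%E].
  move=> freq x r N r0 rr1.
  have r40 : 0 < r / 4 by rewrite divr_gt0.
  have r80 : 0 < r / 8 by rewrite divr_gt0.
  have [N1 N1P] := limn_einf_eventually (cuP x (r / 4) r40).
  have [N2 N2P] := rho_small _ r80.
  have [n nN Tn] := freq (maxn N (maxn N1 N2)).
  move: nN; rewrite !geq_max => /and3P[Nn N1n N2n].
  have [run0 run1 runa] := N2P n N2n.
  have ub : ((c' * (r / 4) `^ D)%:E <= mX (ball x (r / 4) `&`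
      \bigcup_(alpha in Jn beta l u n) rect_nbhd Res alpha (rho (u n)) a))%E.
    apply: (le_trans _ (N1P n N1n)); rewrite /c' -mulrA EFinM.
    apply: lee_wpmul2l; first by rewrite lee_fin ltW.
    by apply: (ball_ge mXE K1 bR); rewrite r40/=; lra.
  have [P [w [rho0 [w0 rho0P oP PV [PE MP frost]]]]] :=
    layer_exists mXE delta_gt0 kappa_ge0 kappa_lt1 K1 r11 bR nR a_gt0 (t_gt0 n)
      run0 run1 r0 rr1 alpha0 runa ub d_gt0 Tn.
  by exists n, P, w, rho0.
pose c0 := content_const (d := d) delta K.
have c00 : 0 < c0 by exact: content_const_gt0.
(* Chosen so that [diam (ball x r) <= L * r']: the first term serves for [r <= r1 / 8], the second
   for larger [r], where the diameter is at most [B]. *)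
pose L := Num.max 2 (8 * B / r1).
have L1 : 1 <= L by rewrite le_max ler1n.
have LD0 : 0 < L `^ D by rewrite powR_gt0// (lt_le_trans ltr01).
have cL0 : 0 < c0 / (2 * L `^ D) by rewrite divr_gt0// mulr_gt0.
(* The 2 makes the inequality strict; [L ^ D] replaces [L ^ T], so that the constant does not depend
   on [T]. *)
exists (c0 / (2 * L `^ D)) => //.
move=> T x r T0 freq r0.
have TD : T <= D.
  have [n _ Tn] := freq 0%N; apply: (le_trans Tn); exact: rect_dim_le_sum.
pose r' := Num.min r (r1 / 8).
have r'0 : 0 < r' by rewrite lt_min r0 divr_gt0.
have r'1 : r' <= r1 / 8 by rewrite ge_min lexx orbT.
have r'T : 0 < r' `^ T by rewrite powR_gt0.
have lower : ((c0 * r' `^ T)%:E <=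
    hausdorff_content T (W beta l u Res rho a t `&` ball x r))%E.
  apply: (@le_trans _ _ (hausdorff_content T (W beta l u Res rho a t `&` ball x r'))).
    apply: le_ereal_inf_tmp => _ [I [y [h [h0 cover ->]]]].
    apply: (limsup_content_ge d_gt0 compactX mXE delta_gt0 K1 r10 r11 bR T0 TD h0
      _ _ (layers T freq) r'0 r'1 cover).
      by rewrite !mulr_gt0// ?invr_gt0 ?powR_gt0// !exprn_gt0// invr_gt0 (lt_le_trans ltr01).
    by rewrite mulr_gt0 ?powR_gt0// exprn_gt0.
  apply: hausdorff_content_subset; apply: setIS => z /ballP xz; apply/ballP.
  by rewrite (lt_le_trans xz)// ge_min lexx.
have upper : (hausdorff_content T (ball x r) <= (L `^ D * r' `^ T)%:E)%E.
  apply: (le_trans (hausdorff_content_ball_le T x r0)); rewrite lee_fin.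
  have L0 : 0 <= L by rewrite (le_trans ler01).
  apply: (@le_trans _ _ ((L * r') `^ T)); last first.
    by rewrite powRM ?(ltW r'0)// ler_wpM2r ?powR_ge0// ler_powR.
  apply: powR_le => //; first exact: diam_ball_ge0.
  rewrite /r'; case: (leP r (r1 / 8)) => rr1.
    by rewrite (le_trans (diam_ball_le _ r0))// ler_wpM2r ?(ltW r0)// le_max lexx.
  apply: (@le_trans _ _ B).
    apply: ge_sup.
      by exists (mdist x x), (x, x) => //; split; apply/ballP; rewrite mdistxx.
    by move=> _ [[p q] _ <-]; exact: BP.
  have -> : B = 8 * B / r1 * (r1 / 8) by field; rewrite gt_eqF.
  by rewrite ler_wpM2r ?divr_ge0 ?(ltW r10)// le_max lexx orbT.
apply: lt_le_trans lower; apply: (@le_lt_trans _ _ ((c0 / (2 * L `^ D))%:E * (L `^ D * r' `^ T)%:E)%E).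
  by apply: lee_wpmul2l => //; rewrite lee_fin ltW.
rewrite -EFinM lte_fin.
have -> : c0 / (2 * L `^ D) * (L `^ D * r' `^ T) = c0 * r' `^ T / 2.
  by field; rewrite gt_eqF.
have : 0 < c0 * r' `^ T by rewrite mulr_gt0.
by move=> ?; lra.
Qed.

Theorem theorem2p13 (R : realType) (d : nat) (d_gt0 : (0 < d)%N)
  (X : 'I_d -> pmetricType R)
  (compactX : forall i, compact [set: X i])
  (m : forall i, {measure set (borelType (X i)) -> \bar R})
  (delta : 'I_d -> R) (delta_gt0 : forall i, 0 < delta i)
  (regm : forall i, ahlfors_regular (m i) (delta i))
  (mX : {measure set (borelType (maxprod X)) -> \bar R})
  (mXE : is_product_measure m mX)
  (J : Type) (J_infinite : infinite_set [set: J])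
  (J_countable : countable [set: J])
  (beta : J -> R) (beta_gt0 : forall alpha, 0 < beta alpha)
  (beta_fin : forall M : R, 1 < M -> finite_set [set alpha | beta alpha < M])
  (l u : nat -> R) (lt_lu : forall n, l n < u n)
  (l_cvg : l n @[n --> \oo] --> +oo)
  (rho : R -> R) (rho_gt0 : forall x, 0 < x -> 0 < rho x)
  (rho_noninc : forall x y, 0 < x -> x <= y -> rho y <= rho x)
  (rho_cvg : rho x @[x --> +oo] --> (0 : R))
  (a : 'I_d -> R) (a_gt0 : forall i, 0 < a i)
  (t : nat -> 'I_d -> R) (t_gt0 : forall n i, 0 < t n i)
  (kappa : 'I_d -> R) (kappa_ge0 : forall i, 0 <= kappa i)
  (kappa_lt1 : forall i, kappa i < 1)
  (Res : forall i, J -> set (X i))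
  (scalingR : forall i, kappa_scaling (m i) (delta i) (kappa i) (Res i))
  (ubiq : uniform_local_ubiquity mX beta l u Res rho a)
  (s : R) (sE : s = limn_sup (fun n => rect_dim delta kappa a (t n))) :
  large_inter1 s (W beta l u Res rho a t) /\
  ((exists phi : nat -> nat,
      [/\ increasing_seq phi,
          nonincreasing_seq (fun k => rect_dim delta kappa a (t (phi k))) &
          rect_dim delta kappa a (t (phi k)) @[k --> \oo] --> s]) ->
   large_inter s (W beta l u Res rho a t)).
Proof.
pose f n := rect_dim delta kappa a (t n).
have f0 n : 0 <= f n by exact: rect_dim_ge0.
have fD n : f n <= \sum_i delta i by exact: rect_dim_le_sum.
have GW : Gdelta (W beta l u Res rho a t).
  apply: (Gdelta_limsup (E := fun n => \bigcup_(alpha in Jn beta l u n)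
    rect_nbhd Res alpha (rho (u n)) (fun i => a i + t n i))) => n.
  by apply: bigcup_open => alpha _; exact: rect_nbhd_open.
have [c c0 cP] := limsup_rectangles_content d_gt0 compactX delta_gt0 regm mXE J_infinite
  lt_lu l_cvg rho_gt0 rho_cvg a_gt0 t_gt0 kappa_ge0 kappa_lt1 scalingR ubiq.
split.
  (* An exponent strictly below the upper limit is at most [f n] for infinitely many [n]. *)
  split=> //; exists c => // T x r T0 Ts r0; apply: cP => //; first exact: ltW.
  by apply: (@limn_sup_frequently _ f (\sum_i delta i)); rewrite -?sE// => n; rewrite f0 fD.
move=> [phi [phi_inc f_ni f_cvg]]; split=> //; exists c => // x r r0.
(* A nonincreasing sequence stays above its limit, so the exponent [s] itself is admissible at every
   level [phi k]. *)
have sf k : s <= f (phi k).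
  rewrite -(cvg_lim _ f_cvg)//; apply: (nonincreasing_cvgn_ge f_ni).
  by apply/cvg_ex; exists s.
apply: cP => //.
  by rewrite -(cvg_lim _ f_cvg)//; apply: limr_ge; [apply/cvg_ex; exists s|apply: nearW => k; exact: f0].
move=> N; exists (phi N); last exact: sf.
(* A strictly increasing [phi] satisfies [N <= phi N]. *)
elim: N => // N IH; apply: (leq_ltn_trans IH).
by rewrite ltnNge; have := phi_inc N.+1 N; rewrite leEnat ltnn => ->.
Qed.
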